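(* Let $(X,x)\subset(\mathbb{C}^n,x)$, $(Y,y)\subset(\mathbb{C}^m,y)$ and $(Z,z)\subset(\mathbb{C}^l,z)$ be germs of complex analytic spaces, with morphisms $\alpha:(Z,z)\to(X,x)$ and $\beta:(Z,z)\to(Y,y)$ whose induced homomorphisms $\alpha_z^*:\mathcal{O}_{X,x}\to\mathcal{O}_{Z,z}$ and $\beta_z^*:\mathcal{O}_{Y,y}\to\mathcal{O}_{Z,z}$ are surjective and not isomorphisms. Let $(\mathcal{V},v)=(X,x)\sqcup_{(Z,z)}(Y,y)$, and suppose that $\dim(\mathcal{V})=\dim(X)$ and that the gluing $(\mathcal{V},v)$ is large. Then $(\mathcal{V},v)$ is smooth if and only if $$\beta_1^{X}(Z)\left(\beta_1^{\mathcal{V}}(Y)\,\mathrm{edim}(X)-\dim(X)\,\beta_1^{X}(Z)+\beta_2^{\mathcal{V}}(Y)\right)=\beta_1^{\mathcal{V}}(Y)\,\beta_2^{X}(Z).$$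
   Context: Germs: for a germ $(X,x)\subset(\mathbb{C}^n,x)$ of a complex analytic space, $\mathcal{O}_{X,x}\cong\mathcal{O}_{\mathbb{C}^n,x}/\mathcal{I}_{X,x}$ where $\mathcal{I}_{X,x}$ is the ideal of all germs of holomorphic functions vanishing on $X$; it is a reduced Noetherian local analytic $\mathbb{C}$-algebra with residue field $\mathbb{C}$. A subspace $(W,w)$ of $(X,x)$ is one defined by a reduced (i.e. radical) ideal $I\subset\mathcal{O}_{X,x}$, with local ring $\mathcal{O}_{X,x}/I$. $\dim(X)$ and $\mathrm{edim}(X)$ denote the Krull dimension and the embedding dimension of $\mathcal{O}_{X,x}$; $(X,x)$ is smooth if $\mathrm{edim}(X)=\dim(X)$. The same notation is used for all germs. Betti numbers and Poincaré series: for a finitely generated $\mathcal{O}_{X,x}$-module $M$, $\beta_i^{\mathcal{O}_{X,x}}(M)=\dim_{\mathbb{C}}\mathrm{Tor}_i^{\mathcal{O}_{X,x}}(M,\mathbb{C})$ and $P^{\mathcal{O}_{X,x}}_M(t)=\sum_{i\ge0}\beta_i^{\mathcal{O}_{X,x}}(M)t^i$. For a subspace $(W,w)$ defined by $I$, $\beta_i^{X}(W)=\beta_i^{(X,x)}(W,w):=\beta_i^{\mathcal{O}_{X,x}}(\mathcal{O}_{X,x}/I)$ and $P^{(X,x)}_{(W,w)}(t):=P^{\mathcal{O}_{X,x}}_{\mathcal{O}_{X,x}/I}(t)$. Gluing: $(\mathcal{V},v)=(X,x)\sqcup_{(Z,z)}(Y,y)$ is the pushout of $\alpha:(Z,z)\to(X,x)$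 and $\beta:(Z,z)\to(Y,y)$, with canonical morphisms $f:(X,x)\to(\mathcal{V},v)$ and $g:(Y,y)\to(\mathcal{V},v)$. Its local ring is the fiber product $\mathcal{O}_{\mathcal{V},v}=\{(s,t)\in\mathcal{O}_{X,x}\times\mathcal{O}_{Y,y}:\alpha_z^*(s)=\beta_z^*(t)\}$, a Noetherian local analytic $\mathbb{C}$-algebra, and $f,g$ correspond to the surjective projections $\pi_1:\mathcal{O}_{\mathcal{V},v}\to\mathcal{O}_{X,x}$ and $\pi_2:\mathcal{O}_{\mathcal{V},v}\to\mathcal{O}_{Y,y}$. Through $\pi_1$ (resp. $\pi_2$), $\mathcal{O}_{X,x}$-modules (resp. $\mathcal{O}_{Y,y}$-modules) are $\mathcal{O}_{\mathcal{V},v}$-modules, and subspaces of $(X,x)$ (resp. $(Y,y)$) are regarded as subspaces of $(\mathcal{V},v)$. Large morphism: a morphism $h:(Y',y')\to(X',x')$ of germs with $\mathcal{O}_{X',x'}\to\mathcal{O}_{Y',y'}$ surjective is large if for every subspace $(W,w)$ of $(Y',y')$, regarded as a subspace of $(X',x')$, one has $P^{(X',x')}_{(W,w)}=P^{(Y',y')}_{(W,w)}P^{(X',x')}_{(Y',y')}$. Large gluing: the morphism $f$ is large. *)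

(* Defs.v *)
From HB Require Import structures.
From mathcomp Require Import all_boot all_order all_algebra.
From mathcomp Require Import ring_quotient complex.
From mathcomp Require Import boolp classical_sets functions reals.
From mathcomp Require Import topology normedtype sequences.

Set Implicit Arguments.
Unset Strict Implicit.
Unset Printing Implicit Defensive.

Import Order.TTheory GRing.Theory Num.Theory numFieldNormedType.Exports.

Local Open Scope ring_scope.
Local Open Scope classical_set_scope.

(* A ring A together with a ring morphism to a field k.  In every use below
   A is the local ring of a germ, k = C, and the morphism is the canonical
   map onto the residue field, so that its kernel is the maximal ideal. *)
Record augRing (k : fieldType) := AugRing {
  aug_ring :> comNzRingType;
  residue : {rmorphism aug_ring -> k} }.

Section KrullDimension.
Variable A : comNzRingType.

Definition prime_chain (d : nat) : Prop :=
  exists p : 'I_d.+1 -> prime_idealr A, forall i j : 'I_d.+1, (i < j)%N ->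
    {subset p i <= p j} /\ ~ {subset p j <= p i}.

(* Chains can be shortened, so at most one d satisfies the condition.
   The default 0 is only taken for rings of infinite dimension. *)
Definition krull_dim : nat :=
  xget 0%N [set d | prime_chain d /\ ~ prime_chain d.+1].

End KrullDimension.

Section EmbeddingDimension.
Variables (k : fieldType) (A : augRing k).

Definition in_max (u : A) : Prop := residue A u = 0.

Definition in_max_sq (u : A) : Prop :=
  exists (r : nat) (a b : 'I_r -> A),
    (forall i, in_max (a i) /\ in_max (b i)) /\ u = \sum_i a i * b i.

(* The classes of the v i form a basis of m / m^2 over A / m; scalars of A / m
   are represented by elements of A. *)
Definition cotangent_basis (d : nat) (v : 'I_d -> A) : Prop :=
  [/\ forall i, in_max (v i),
      forall u, in_max u ->
        exists c : 'I_d -> A, in_max_sq (u - \sum_i c i * v i)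
    & forall c : 'I_d -> A, in_max_sq (\sum_i c i * v i) ->
        forall i, in_max (c i)].

Definition edim : nat :=
  xget 0%N [set d | exists v : 'I_d -> A, cotangent_basis v].

Definition smooth : Prop := edim = krull_dim A.

End EmbeddingDimension.

(* Resolutions of M by free modules of finite rank.  Vectors are rows: the
   differential A^(fr_rank i.+1) -> A^(fr_rank i) is v |-> v *m fr_diff i. *)
Record free_resolution (A : comNzRingType) (M : lmodType A) := FreeResolution {
  fr_rank : nat -> nat;
  fr_diff : forall i, 'M[A]_(fr_rank i.+1, fr_rank i);
  fr_augm : {linear 'rV[A]_(fr_rank 0) -> M};
  fr_augm_surj : forall x, exists v, fr_augm v = x;
  fr_exact0 : forall v, fr_augm v = 0 <-> exists w, v = w *m fr_diff 0;
  fr_exactS : forall i (v : 'rV[A]_(fr_rank i.+1)),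
    v *m fr_diff i = 0 <-> exists w, v = w *m fr_diff i.+1 }.

Section Betti.
Variables (k : fieldType) (A : augRing k) (M : lmodType A).

(* F (x)_A k is the complex of the spaces k^(fr_rank F i), whose differentials are
   the matrices of F reduced to k. *)
Definition diff_res (F : free_resolution M) (i : nat) :
  'M[k]_(fr_rank F i.+1, fr_rank F i) := map_mx (residue A) (fr_diff F i).

(* dim_k Tor_i^A(M, k), computed as dim_k H_i(F (x)_A k). *)
Definition tor_dim (F : free_resolution M) (i : nat) : nat :=
  match i with
  | 0 => fr_rank F 0 - \rank (diff_res F 0)
  | j.+1 => \rank (kermx (diff_res F j)) - \rank (diff_res F j.+1)
  end.

(* The value does not depend on F, and F exists for M finitely generated over
   a Noetherian ring, the only case in which Betti numbers are used. *)
Definition betti (i : nat) : nat :=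
  xget 0%N [set b | exists F : free_resolution M, b = tor_dim F i].

End Betti.

Arguments betti {k} A M i.

(* The sequence of coefficients of the Poincare series. *)
Definition poincare (k : fieldType) (A : augRing k) (M : lmodType A) :
  nat -> nat := fun i => betti A M i.

Arguments poincare {k} A M.

Definition series_mul (p q : nat -> nat) : nat -> nat :=
  fun i => (\sum_(j < i.+1) p j * q (i - j))%N.

(* Restriction of scalars. *)
Definition restr (A B : comNzRingType) (h : {rmorphism A -> B})
  (M : lmodType B) : Type := M.

Section Restriction.
Variables (A B : comNzRingType) (h : {rmorphism A -> B}) (M : lmodType B).

HB.instance Definition _ := GRing.Zmodule.on (restr h M).

Definition restr_scale (a : A) (x : restr h M) : restr h M := h a *: (x : M).

Lemma restr_scaleA a b x :
  restr_scale a (restr_scale b x) = restr_scale (a * b) x.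
Proof. by rewrite /restr_scale scalerA rmorphM. Qed.

Lemma restr_scale1 : left_id 1 restr_scale.
Proof. by move=> x; rewrite /restr_scale rmorph1 scale1r. Qed.

Lemma restr_scaleDr : right_distributive restr_scale +%R.
Proof. by move=> a x y; rewrite /restr_scale scalerDr. Qed.

Lemma restr_scaleDl x : {morph restr_scale^~ x : a b / a + b}.
Proof. by move=> a b; rewrite /restr_scale rmorphD scalerDl. Qed.

HB.instance Definition _ := GRing.Zmodule_isLmodule.Build A (restr h M)
  restr_scaleA restr_scale1 restr_scaleDr restr_scaleDl.

End Restriction.

(* B as an A-module through h. *)
Definition pull_module (A B : comNzRingType) (h : {rmorphism A -> B}) :
  lmodType A := restr h B^o.

Section QuotientMap.
Variables (A : comNzRingType) (I : idealr A).

Definition quot_map (a : A) : {ideal_quot I} := (\pi_({ideal_quot I}) a)%qT.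

Lemma quot_map_zmod : zmod_morphism quot_map.
Proof. by move=> x y; rewrite /quot_map !piE. Qed.

Lemma quot_map_monoid : monoid_morphism quot_map.
Proof. by split=> [|x y]; rewrite /quot_map !piE. Qed.

HB.instance Definition _ :=
  GRing.isZmodMorphism.Build A {ideal_quot I} quot_map quot_map_zmod.
HB.instance Definition _ :=
  GRing.isMonoidMorphism.Build A {ideal_quot I} quot_map quot_map_monoid.

(* A / I as an A-module. *)
Definition quot_module : lmodType A := pull_module quot_map.

End QuotientMap.

Definition radical (A : comNzRingType) (I : idealr A) : Prop :=
  forall (a : A) (r : nat), a ^+ r \in I -> a \in I.

(* h : A -> B is the surjection of local rings of a morphism of germs.  The
   subspaces of its source are given by the (proper) radical ideals I of B. *)
Definition large (k : fieldType) (A B : augRing k) (h : {rmorphism A -> B}) :=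
  forall I : idealr B, radical I ->
    poincare A (restr h (quot_module I)) =
    series_mul (poincare B (quot_module I)) (poincare A (pull_module h)).

Section FiberProduct.
Variables (A B K : comNzRingType).
Variables (a : {rmorphism A -> K}) (b : {rmorphism B -> K}).

Definition fiber_pred : {pred A * B} := fun p => a p.1 == b p.2.

Lemma fiber_subring : subring_closed fiber_pred.
Proof.
split=> [|p q|p q]; rewrite !unfold_in /= ?rmorph1 //.
  by move=> /eqP pE /eqP qE; rewrite !rmorphB /= pE qE.
by move=> /eqP pE /eqP qE; rewrite !rmorphM /= pE qE.
Qed.

HB.instance Definition _ := GRing.isSubringClosed.Build (A * B)%type fiber_pred
  fiber_subring.

Definition fiber : Type := {p : A * B | p \in fiber_pred}.

HB.instance Definition _ := SubChoice.on fiber.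
HB.instance Definition _ :=
  [SubChoice_isSubComNzRing of fiber by <:].

Definition proj1 (p : fiber) : A := (\val p).1.
Definition proj2 (p : fiber) : B := (\val p).2.

HB.instance Definition _ := GRing.RMorphism.copy proj1 (fst \o \val).
HB.instance Definition _ := GRing.RMorphism.copy proj2 (snd \o \val).

End FiberProduct.

Definition Cx (R : realType) : numClosedFieldType := R[i].

Section PowerSeries.
Variables (R : realType) (n : nat).
Local Notation C := (Cx R).
Local Notation mindex := {ffun 'I_n -> nat}.
Local Notation box N := {ffun 'I_n -> 'I_N.+1}.

Definition box_val N (k : box N) : mindex := [ffun i => k i : nat].

Definition mon (h : 'rV[C]_n) (m : mindex) : C := \prod_i h 0 i ^+ m i.

(* Partial sum of sum_m a_m h^m over the multi-indices with entries <= N. *)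
Definition psum (a : mindex -> C) (h : 'rV[C]_n) (N : nat) : C :=
  \sum_(k : box N) a (box_val k) * mon h (box_val k).

(* f is, near x, the sum of a power series that converges absolutely on some
   polydisc centred at x. *)
Definition holomorphic_at (x : 'rV[C]_n) (f : 'rV[C]_n -> C) : Prop :=
  exists (a : mindex -> C) (r M : C),
    [/\ 0 < r,
        forall N, psum (fun m => `|a m|) (const_mx r) N <= M
      & \forall z \near x, psum a (z - x) N @[N --> \oo] --> f z].

Lemma mon_const (r : C) (m : mindex) :
  mon (const_mx r) m = r ^+ (\sum_i m i)%N.
Proof. by rewrite expr_sum; apply: eq_bigr => i _; rewrite mxE. Qed.

Lemma ler_psum (a : mindex -> C) (r s : C) N : 0 <= s -> s <= r ->
  psum (fun m => `|a m|) (const_mx s) N <= psum (fun m => `|a m|) (const_mx r) N.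
Proof.
move=> s0 sr; apply: ler_sum => k _; rewrite ler_wpM2l ?normr_ge0 //.
by rewrite !mon_const lerXn2r // ?nnegrE // (le_trans s0).
Qed.

Lemma psum_ge0 (a : mindex -> C) (r : C) N : 0 <= r ->
  0 <= psum (fun m => `|a m|) (const_mx r) N.
Proof.
move=> r0; apply: sumr_ge0 => k _.
by rewrite mulr_ge0 ?normr_ge0 // mon_const exprn_ge0.
Qed.

Lemma holomorphic_cst (x : 'rV[C]_n) (c : C) : holomorphic_at x (fun=> c).
Proof.
have psumE (d : C) h N :
    psum (fun m => if m == [ffun=> 0%N] then d else 0) h N = d.
  rewrite /psum (bigD1 [ffun=> ord0]) //= big1 => [|k kN0].
    have -> : box_val [ffun=> ord0 : 'I_N.+1] = [ffun=> 0%N].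
      by apply/ffunP => i; rewrite !ffunE.
    rewrite eqxx addr0 /mon big1 ?mulr1 // => i _.
    by rewrite ffunE expr0.
  case: eqP => [k0|]; last by rewrite mul0r.
  case/eqP: kN0; apply/ffunP => i; rewrite ffunE; apply: val_inj => /=.
  by move/ffunP: k0 => /(_ i); rewrite !ffunE.
exists (fun m => if m == [ffun=> 0%N] then c else 0), 1, `|c|; split=> //.
  move=> N; rewrite (_ : (fun m => _) =
      fun m => if m == [ffun=> 0%N] then `|c| else 0) ?psumE //.
  by apply/funext => m; case: ifP; rewrite ?normr0.
near=> z; rewrite (_ : psum _ _ = fun=> c); first exact: cvg_cst.
by apply/funext => N; rewrite psumE.
Unshelve. all: by end_near. Qed.

Lemma min_radius (r s : C) : 0 < r -> 0 < s ->
  exists t : C, [/\ 0 < t, t <= r & t <= s].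
Proof.
move=> r0 s0; have [rs|sr] := real_leP (gtr0_real r0) (gtr0_real s0).
  by exists r.
by exists s; split=> //; exact: ltW.
Qed.

Lemma holomorphicB (x : 'rV[C]_n) f g :
  holomorphic_at x f -> holomorphic_at x g -> holomorphic_at x (f - g).
Proof.
move=> [a [r [M [r0 aM af]]]] [b [s [L [s0 bL bg]]]].
have [t [t0 tr ts]] := min_radius r0 s0.
exists (fun m => a m - b m), t, (M + L); split=> [//|N|].
  apply: (@le_trans _ _ (psum (fun m => `|a m|) (const_mx t) N +
                         psum (fun m => `|b m|) (const_mx t) N)).
    rewrite /psum -big_split /=; apply: ler_sum => k _.
    rewrite -mulrDl ler_wpM2r ?mon_const ?exprn_ge0 ?(ltW t0) //.
    exact: ler_normB.
  apply: lerD.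
    by apply: le_trans (aM N); rewrite ler_psum // ltW.
  by apply: le_trans (bL N); rewrite ler_psum // ltW.
apply: filterS2 af bg => z afz bgz.
have -> : psum (fun m => a m - b m) (z - x) =
    fun N => psum a (z - x) N - psum b (z - x) N.
  apply/funext => N /=; rewrite /psum -sumrB.
  by apply: eq_bigr => k _; rewrite mulrBl.
exact: (cvgB afz bgz).
Qed.

Definition box_le N (k : box N) (m : mindex) := [forall i, (k i <= m i)%N].

Definition mindex_sub (m k : mindex) : mindex := [ffun i => (m i - k i)%N].

(* Cauchy product. *)
Definition conv (a b : mindex -> C) (m : mindex) : C :=
  \sum_(k : box (\sum_i m i) | box_le k m)
    a (box_val k) * b (mindex_sub m (box_val k)).

Lemma conv_widen (F : mindex -> C) (m : mindex) N N' :
  (forall i, (m i <= N)%N) -> (N <= N')%N ->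
  \sum_(k : box N | box_le k m) F (box_val k) =
  \sum_(k : box N' | box_le k m) F (box_val k).
Proof.
move=> mN NN'.
pose up (k : box N) : box N' := [ffun i => inord (k i)].
pose dn (k : box N') : box N := [ffun i => inord (k i)].
have upE k i : up k i = k i :> nat.
  by rewrite ffunE inordK // ltnS (leq_trans (leq_ord _)).
have upV k : box_val (up k) = box_val k.
  by apply/ffunP => i; rewrite !(ffunE (fun _ => nat_of_ord _)) upE.
rewrite [RHS](reindex_onto up dn) => [|k /forallP km]; last first.
  apply/ffunP => i; apply: val_inj; rewrite /= upE ffunE inordK //.
  by rewrite ltnS (leq_trans (km i)).
apply: eq_big => k.
  rewrite (_ : dn (up k) = k) ?eqxx ?andbT.
    by apply: eq_forallb => i; rewrite upE.
  by apply/ffunP => i; apply: val_inj; rewrite /= ffunE inordK upE.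
by rewrite upV.
Qed.

Lemma convE a b (m : mindex) N : (forall i, (m i <= N)%N) ->
  conv a b m = \sum_(k : box N | box_le k m)
    a (box_val k) * b (mindex_sub m (box_val k)).
Proof.
move=> mN; pose F k := a k * b (mindex_sub m k).
have mS i : (m i <= \sum_i m i)%N by rewrite (bigD1 i) //= leq_addr.
rewrite /conv (@conv_widen F m _ (maxn N (\sum_i m i))) ?leq_maxr //.
by rewrite -(@conv_widen F m N) ?leq_maxl.
Qed.

Definition add_le N (k l : box N) := [forall i, (k i + l i <= N)%N].

Lemma psum_conv a b h N : psum (conv a b) h N =
  \sum_(k : box N) \sum_(l : box N | add_le k l)
    (a (box_val k) * mon h (box_val k)) * (b (box_val l) * mon h (box_val l)).
Proof.
have vE (k : box N) i : box_val k i = k i by rewrite ffunE.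
rewrite /psum.
under eq_bigr => m _.
  rewrite (@convE _ _ _ N); last by move=> i; rewrite vE leq_ord.
  rewrite big_distrl /=; over.
rewrite (exchange_big_dep predT) //=; apply: eq_bigr => k _.
pose up (l : box N) : box N := [ffun i => inord (k i + l i)].
pose dn (l : box N) : box N := [ffun i => inord (l i - k i)].
have upE (l : box N) i : (k i + l i <= N)%N -> up l i = (k i + l i)%N :> nat.
  by move=> ?; rewrite ffunE inordK.
have dnE (l : box N) i : dn l i = (l i - k i)%N :> nat.
  by rewrite ffunE inordK // ltnS (leq_trans (leq_subr _ _)) // leq_ord.
rewrite (reindex_onto up dn) => [|m /forallP km]; last first.
  have km' i : (k i <= m i)%N by rewrite -(vE m).
  by apply/ffunP => i; apply: val_inj; rewrite /= upE dnE subnKC ?leq_ord.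
have main (l : box N) : add_le k l ->
    [/\ box_le k (box_val (up l)), dn (up l) = l &
     forall i, box_val (up l) i = (k i + l i)%N].
  move=> /forallP kl; split.
  - by apply/forallP => i; rewrite vE upE // leq_addr.
  - by apply/ffunP => i; apply: val_inj; rewrite /= dnE upE // addKn.
  - by move=> i; rewrite vE upE.
apply: eq_big => l.
  apply/idP/idP => [/andP[/forallP kl /eqP dl]|/main[-> -> _]]; last first.
    by rewrite eqxx.
  apply/forallP => i; have := congr1 (fun f : box N => f i : nat) dl.
  rewrite /= dnE => <-; rewrite subnKC ?leq_ord //.
  by have := kl i; rewrite vE.
move=> /andP[kl /eqP dl].
have [|_ _ uE] := main l.
  apply/forallP => i; have := congr1 (fun f : box N => f i : nat) dl.
  rewrite /= dnE => <-; rewrite subnKC ?leq_ord //.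
  by move/forallP: kl => /(_ i); rewrite vE.
have -> : mindex_sub (box_val (up l)) (box_val k) = box_val l.
  by apply/ffunP => i; rewrite ffunE uE !vE addKn.
have -> : mon h (box_val (up l)) = mon h (box_val k) * mon h (box_val l).
  rewrite /mon -big_split; apply: eq_bigr => i _ /=.
  by rewrite uE exprD !vE.
by rewrite mulrACA.
Qed.

Lemma psum_conv_le a b (r : C) N : 0 <= r ->
  psum (fun m => `|conv a b m|) (const_mx r) N <=
  psum (fun m => `|a m|) (const_mx r) N * psum (fun m => `|b m|) (const_mx r) N.
Proof.
move=> r0; have mon0 k : 0 <= mon (const_mx r) k.
  by rewrite mon_const exprn_ge0.
apply: (@le_trans _ _ (psum (conv (fun m => `|a m|) (fun m => `|b m|))
                            (const_mx r) N)).
  apply: ler_sum => k _; rewrite ler_wpM2r //.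
  apply: le_trans (ler_norm_sum _ _ _) _.
  by apply: ler_sum => l _; rewrite normrM.
rewrite psum_conv {2}/psum big_distrl /=; apply: ler_sum => k _.
rewrite big_distrr /= [leRHS](bigID (add_le k)) /= lerDl.
by apply: sumr_ge0 => l _; rewrite !mulr_ge0.
Qed.

Lemma half_expn_small (e : C) : 0 < e -> exists N0 : nat, forall N,
  (N0 <= N)%N -> 2^-1 ^+ N < e.
Proof.
move=> e0; have einv : 0 < e^-1 by rewrite invr_gt0.
have [u uE] : exists u : R, e^-1 = (u%:C)%C.
  by exists (complex.Re e^-1); rewrite complex.RRe_real // gtr0_real.
exists (Num.truncn u).+1 => N uN.
rewrite exprVn -[e]invrK ltf_pV2 ?posrE ?exprn_gt0 //.
apply: (@lt_le_trans _ _ ((Num.truncn u).+1%:R)).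
  by rewrite uE -(rmorph_nat (real_complex R)) complex.ltcR truncnS_gt.
rewrite -natrX ler_nat (leq_trans uN) // ltnW // ltn_expl //.
Qed.

Lemma psum_conv_diff a b (h : 'rV[C]_n) (r M L : C) : 0 < r ->
  (forall i, `|h 0 i| <= r / 2) ->
  (forall N, psum (fun m => `|a m|) (const_mx r) N <= M) ->
  (forall N, psum (fun m => `|b m|) (const_mx r) N <= L) ->
  forall N, `|psum a h N * psum b h N - psum (conv a b) h N| <=
            M * L * 2^-1 ^+ N.
Proof.
move=> r0 hr aM bL N.
have hle (c : mindex -> C) k : `|c k * mon h k| <=
    `|c k| * mon (const_mx r) k * 2^-1 ^+ (\sum_i k i)%N.
  rewrite normrM -mulrA ler_wpM2l // mon_const -exprMn -mon_const.
  rewrite /mon normr_prod; apply: ler_prod => i _.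
  by rewrite normr_ge0 normrX mxE lerXn2r ?nnegrE ?normr_ge0 ?hr //
    divr_ge0 // ltW.
have mon0 k : 0 <= mon (const_mx r) k by rewrite mon_const exprn_ge0 // ltW.
rewrite psum_conv {1 2}/psum big_distrl -sumrB /=.
pose T (c : mindex -> C) k := `|c k| * mon (const_mx r) k.
have T0 c k : 0 <= T c k by rewrite mulr_ge0.
apply: (@le_trans _ _ (\sum_(k : box N) \sum_(l : box N)
    T a (box_val k) * T b (box_val l) * 2^-1 ^+ N)); last first.
  rewrite (eq_bigr (fun k : box N => T a (box_val k) *
     (psum (fun m => `|b m|) (const_mx r) N * 2^-1 ^+ N))) => [|k _].
    rewrite -big_distrl /= mulrA ler_wpM2r ?exprn_ge0 ?invr_ge0 //.
    have := ler_pM (psum_ge0 a N (ltW r0)) (psum_ge0 b N (ltW r0)) (aM N) (bL N).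
    by [].
  by rewrite /psum big_distrl big_distrr /=; apply: eq_bigr => l _; rewrite -[LHS]mulrA.
apply: le_trans (ler_norm_sum _ _ _) _; apply: ler_sum => k _.
rewrite big_distrr /= [X in X - _](bigID (add_le k)) /= addrAC subrr add0r.
apply: le_trans (ler_norm_sum _ _ _) _.
rewrite [leRHS](bigID (add_le k)) /= -[leLHS]add0r lerD //.
  by apply: sumr_ge0 => l _; rewrite !mulr_ge0 // exprn_ge0 // invr_ge0.
apply: ler_sum => l; rewrite negb_forall => /existsP[j]; rewrite -ltnNge => Nkl.
rewrite normrM; apply: le_trans (ler_pM _ _ (hle _ _) (hle _ _)) _ => //.
rewrite mulrACA ler_wpM2l ?mulr_ge0 // -exprD.
rewrite ler_wiXn2l ?invr_ge0 ?invf_le1 ?ler1n // (leq_trans (ltnW Nkl)) //.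
by rewrite leq_add // (bigD1 j) //= ffunE leq_addr.
Qed.

Lemma holomorphicM (x : 'rV[C]_n) f g :
  holomorphic_at x f -> holomorphic_at x g -> holomorphic_at x (f * g).
Proof.
move=> [a [r [M [r0 aM af]]]] [b [s [L [s0 bL bg]]]].
have [t [t0 tr ts]] := min_radius r0 s0.
have aMt N : psum (fun m => `|a m|) (const_mx t) N <= M.
  by apply: le_trans (aM N); rewrite ler_psum // ltW.
have bLt N : psum (fun m => `|b m|) (const_mx t) N <= L.
  by apply: le_trans (bL N); rewrite ler_psum // ltW.
have ML0 : 0 <= M * L.
  by rewrite mulr_ge0 //; [apply: le_trans (aMt 0%N)|apply: le_trans (bLt 0%N)];
    rewrite psum_ge0 // ltW.
exists (conv a b), t, (M * L); split=> [//|N|].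
  apply: le_trans (psum_conv_le _ _ _ (ltW t0)) _.
  by rewrite ler_pM ?psum_ge0 // ltW.
have t2 : 0 < t / 2 by rewrite divr_gt0.
apply: filterS3 af bg (nbhsx_ballx x _ t2) => z afz bgz [_ xz].
have zx i : `|(z - x) 0 i| <= t / 2.
  by rewrite !mxE distrC ltW //; have := xz 0 i.
pose D N := psum a (z - x) N * psum b (z - x) N - psum (conv a b) (z - x) N.
have -> : psum (conv a b) (z - x) =
    fun N => psum a (z - x) N * psum b (z - x) N - D N.
  by apply/funext => N; rewrite subKr.
have D0 : D N @[N --> \oo] --> (0 : C).
  apply/cvgr0Pnorm_lt => e e0.
  have [N0 N0e] : exists N0 : nat, forall N, (N0 <= N)%N ->
      2^-1 ^+ N < e / (M * L + 1).
    by apply: half_expn_small; rewrite divr_gt0 // ltr_wpDl.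
  exists N0 => // N /= /N0e Ne.
  apply: le_lt_trans (psum_conv_diff t0 zx aMt bLt N) _.
  apply: (@le_lt_trans _ _ ((M * L + 1) * 2^-1 ^+ N)).
    by rewrite ler_wpM2r ?exprn_ge0 ?invr_ge0 // lerDl.
  by rewrite mulrC -ltr_pdivlMr // ltr_wpDl.
rewrite -[(f * g) z]subr0.
exact: (cvgB (cvgM afz bgz) D0).
Qed.

End PowerSeries.

Section HolomorphicGerms.
Variables (R : realType) (n : nat) (x : 'rV[Cx R]_n).
Local Notation C := (Cx R).

Definition holo_pred : {pred 'rV[C]_n -> C} := fun f => `[< holomorphic_at x f >].

Lemma holo_subring : subring_closed holo_pred.
Proof.
split=> [|f g /asboolP hf /asboolP hg|f g /asboolP hf /asboolP hg];
  apply/asboolP.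
- exact: holomorphic_cst.
- exact: holomorphicB.
- exact: holomorphicM.
Qed.

HB.instance Definition _ :=
  GRing.isSubringClosed.Build ('rV[C]_n -> C) holo_pred holo_subring.

(* The functions holomorphic at x.  Two of them with the same germ at x are
   identified only in the quotient rings local_ring below. *)
Definition holo : Type := {f : 'rV[C]_n -> C | f \in holo_pred}.

HB.instance Definition _ := SubChoice.on holo.
HB.instance Definition _ := [SubChoice_isSubComNzRing of holo by <:].

End HolomorphicGerms.

(* A germ of a complex analytic space (X, x) in (C^n, x), given by a
   representative of the set. *)
Record germ (R : realType) (n : nat) := Germ {
  gset : set 'rV[Cx R]_n;
  gpt : 'rV[Cx R]_n;
  gpt_in : gset gpt;
  germ_analytic : exists (r : nat) (f : 'I_r -> 'rV[Cx R]_n -> Cx R),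
    (forall j, holomorphic_at gpt (f j)) /\
    \forall z \near gpt, gset z <-> forall j, f j z = 0 }.

Section LocalRing.
Variables (R : realType) (n : nat) (X : germ R n).
Local Notation C := (Cx R).

Definition vanishing : {pred holo (gpt X)} :=
  fun f => `[< \forall z \near gpt X, gset X z -> val f z = 0 >].

Lemma vanishing_ideal : idealr_closed vanishing.
Proof.
split=> [| |a f g /asboolP hf /asboolP hg].
- by apply/asboolP; near=> z.
- apply/negP => /asboolP /nbhs_singleton /(_ (gpt_in X)) /eqP.
  by rewrite (_ : _ (gpt X) = 1) ?oner_eq0.
- apply/asboolP; apply: filterS2 hf hg => z fz gz Xz.
  rewrite (_ : _ z = val a z * val f z + val g z) //.
  by rewrite fz // gz // mulr0 addr0.
Unshelve. all: by end_near. Qed.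

HB.instance Definition _ :=
  isIdealr.Build (holo (gpt X)) vanishing vanishing_ideal.

(* O_(X,x) = O_(C^n,x) / I_(X,x). *)
Definition local_ring : comNzRingType := {ideal_quot vanishing}.

Definition to_local (f : holo (gpt X)) : local_ring := quot_map vanishing f.

HB.instance Definition _ :=
  GRing.RMorphism.copy to_local (quot_map vanishing).

Definition eval_pt (s : local_ring) : C := val (repr s) (gpt X).

Lemma eval_ptE (f : holo (gpt X)) : eval_pt (to_local f) = val f (gpt X).
Proof.
have : repr (to_local f) - f \in vanishing.
  by rewrite Quotient.idealrBE reprK.
move=> /asboolP /nbhs_singleton /(_ (gpt_in X)).
by move/eqP; rewrite subr_eq0 => /eqP.
Qed.

Lemma to_local_surj (s : local_ring) : exists f, s = to_local f.
Proof. by exists (repr s); rewrite /to_local /quot_map reprK. Qed.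

Lemma eval_pt_zmod : zmod_morphism eval_pt.
Proof.
move=> s t; have [f ->] := to_local_surj s; have [g ->] := to_local_surj t.
by rewrite -rmorphB !eval_ptE.
Qed.

Lemma eval_pt_monoid : monoid_morphism eval_pt.
Proof.
split=> [|s t]; first by rewrite -(rmorph1 to_local) eval_ptE.
have [f ->] := to_local_surj s; have [g ->] := to_local_surj t.
by rewrite -rmorphM !eval_ptE.
Qed.

HB.instance Definition _ :=
  GRing.isZmodMorphism.Build local_ring C eval_pt eval_pt_zmod.
HB.instance Definition _ :=
  GRing.isMonoidMorphism.Build local_ring C eval_pt eval_pt_monoid.

(* The residue field of O_(X,x) is C, through evaluation at x. *)
Definition local_alg : augRing C := AugRing eval_pt.

End LocalRing.

Arguments to_local {R n} X f.

(* A morphism of germs: (the germ of) a map with holomorphic components, with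
   its comorphism f |-> f o alpha, which is determined by the map. *)
Record germ_morphism (R : realType) (l n : nat)
    (Z : germ R l) (X : germ R n) := GermMorphism {
  gm_map : 'rV[Cx R]_l -> 'rV[Cx R]_n;
  gm_holo : forall i, holomorphic_at (gpt Z) (fun w => gm_map w 0 i);
  gm_pt : gm_map (gpt Z) = gpt X;
  gm_set : \forall w \near gpt Z, gset Z w -> gset X (gm_map w);
  gm_pull : {rmorphism local_alg X -> local_alg Z};
  gm_pullE : forall (f : holo (gpt X)) (g : holo (gpt Z)),
    gm_pull (to_local X f) = to_local Z g ->
    \forall w \near gpt Z, gset Z w -> val g w = val f (gm_map w) }.

Section Gluing.
Variables (R : realType) (n m l : nat).
Variables (X : germ R n) (Y : germ R m) (Z : germ R l).
Variables (alpha : germ_morphism Z X) (beta : germ_morphism Z Y).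

Definition glue_ring : comNzRingType := fiber (gm_pull alpha) (gm_pull beta).

Definition glue_pr1 : {rmorphism glue_ring -> local_alg X} :=
  @proj1 _ _ _ (gm_pull alpha) (gm_pull beta).
Definition glue_pr2 : {rmorphism glue_ring -> local_alg Y} :=
  @proj2 _ _ _ (gm_pull alpha) (gm_pull beta).

(* O_(V,v) for the pushout (V, v) of alpha and beta.  The residue map is
   evaluation at v, the common image of the base points. *)
Definition glue : augRing (Cx R) :=
  AugRing (residue (local_alg X) \o glue_pr1 : {rmorphism glue_ring -> Cx R}).

Definition large_gluing : Prop := @large _ glue (local_alg X) glue_pr1.

End Gluing.

(* Main.v *)
From HB Require Import structures.
Require Import Defs.
From mathcomp Require Import all_boot all_order all_algebra reals.
From mathcomp Require Import ring_quotient complex boolp classical_sets.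
From mathcomp Require Import topology normedtype sequences ring.

Set Implicit Arguments.
Unset Strict Implicit.
Unset Printing Implicit Defensive.

Import Order.TTheory GRing.Theory Num.Theory numFieldNormedType.Exports.
Local Open Scope ring_scope.

(* Write A, B, K, V for the local rings of X, Y, Z and the gluing, and
   I, J for the kernels of A -> K and B -> K.  As J is the kernel of V -> A and
   I that of V -> B, the kernel of V -> K is the direct sum of I and J, so
   b2^V(K) <= b2^V(A) + b2^V(B).  Largeness applied to Z computes
   b2^V(K) = b2^A(K) + b1^A(K) b1^V(A) + b2^V(A), whence a lower bound on
   b2^V(B); lifting a minimal A-presentation of I to V gives the same upper
   bound, so b2^V(B) = b2^A(K) + b1^A(K) b1^V(A), while b1^V(B) = b1^A(K).
   Largeness applied to the point gives edim V = edim A + b1^V(A).  The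
   displayed equation thus becomes b1^A(K)^2 (edim V - dim X) = 0, and
   b1^A(K) > 0 because I <> 0.

   Finite free resolutions exist because these rings are local and Noetherian.
   For convergent power series this is proved by Grauert's division theorem:
   ordering monomials z^m by the integer prod p_i^(m_i), with p_i distinct
   primes, makes the order compatible with the l^1 norms on the polydiscs of
   radii p_i^(-t), for which the tail of a series is negligible against its
   leading term as t grows. *)

(** * Resolutions and Betti numbers over local Noetherian rings *)

Section Noetherian.
Variable A : comNzRingType.

Definition submodule n (Q : 'rV[A]_n -> Prop) : Prop :=
  Q 0 /\ forall a x y, Q x -> Q y -> Q (a *: x + y).

Definition row_span r n (D : 'M[A]_(r, n)) (v : 'rV[A]_n) : Prop :=
  exists w, v = w *m D.

Lemma submodule_mulmx n (Q : 'rV[A]_n -> Prop) r (D : 'M[A]_(r, n)) :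
  submodule Q -> (forall i, Q (row i D)) -> forall w, Q (w *m D).
Proof.
move=> [Q0 QD] DQ w; rewrite mulmx_sum_row; elim/big_ind: _ => //.
  by move=> x y Qx Qy; rewrite -[x]scale1r; apply: QD.
by move=> i _; rewrite -[_ *: _]addr0; apply: QD.
Qed.

(** Ideals are encoded as submodules of [A^1], so that row vectors and row spans serve ideals,
    submodules of [A^n] and syzygies alike. *)
Definition noetherian : Prop := forall Q : 'rV[A]_1 -> Prop, submodule Q ->
  exists r (D : 'M[A]_(r, 1)), forall v, Q v <-> row_span D v.

(** Induction on [n]: the first coordinates of members of [Q] form an ideal, and the members with
    first coordinate 0 form a submodule of [A^n]. Generators of both assemble into a block
    triangular matrix. *)
Lemma noetherian_submodule : noetherian -> forall n (Q : 'rV[A]_n -> Prop),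
  submodule Q -> exists r (D : 'M[A]_(r, n)), forall v, Q v <-> row_span D v.
Proof.
move=> nA; elim=> [|n IHn]; last rewrite -(add1n n); move=> Q [Q0 QD].
  exists 0%N, 0 => v; rewrite thinmx0; split=> // _.
  by exists 0; rewrite mul0mx.
have [|r1 [D1 D1P]] := nA (fun x => exists y, Q (row_mx x y)).
  split; first by exists 0; rewrite row_mx0.
  move=> a x x' [y Qy] [y' Qy']; exists (a *: y + y').
  by rewrite -add_row_mx -scale_row_mx; apply: QD.
have [|r2 [D2 D2P]] := IHn (fun y => Q (row_mx 0 y)).
  split; first by rewrite row_mx0.
  by move=> a x y Qx Qy; have := QD a _ _ Qx Qy;
     rewrite scale_row_mx add_row_mx scaler0 addr0.
have /choice[f fP] : forall i, exists y, Q (row_mx (row i D1) y).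
  by move=> i; apply/D1P; exists (delta_mx 0 i); rewrite -rowE.
pose E := \matrix_i f i.
exists (r1 + r2)%N, (block_mx D1 E 0 D2) => v; split; last first.
  case=> w ->; apply: submodule_mulmx => // l.
  rewrite -[l]splitK; case: (fintype.split l) => j /=.
    by rewrite /block_mx rowKu row_row_mx /E rowK.
  rewrite /block_mx rowKd row_row_mx row0; apply/D2P.
  by exists (delta_mx 0 j); rewrite -rowE.
rewrite -[v](@hsubmxK _ 1 1 n); set x := lsubmx _; set y := rsubmx _ => Qv.
have /D1P[w xE] : exists y, Q (row_mx x y) by exists y.
have /D2P[u uE] : Q (row_mx 0 (y - w *m E)).
  have : Q (row_mx x (w *m E)).
    rewrite xE -mul_mx_row; apply: submodule_mulmx => // i.
    by rewrite row_row_mx /E rowK.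
  move=> /(QD (-1) _ _)/(_ Qv).
  by rewrite scale_row_mx add_row_mx !scaleN1r addNr addrC.
exists (row_mx w u); rewrite mul_row_block mulmx0 addr0 -xE -uE.
by rewrite addrC subrK.
Qed.

End Noetherian.

Section LocalAlgebra.
Variables (k : fieldType) (A : augRing k).
Local Notation res := (residue A).

(** The second clause makes [k] the residue field, and the third makes the kernel of [res] the only
    maximal ideal. *)
Definition local_noetherian : Prop :=
  [/\ noetherian A, forall c, exists a, res a = c
    & forall a, res a != 0 -> exists b, b * a = 1].

Hypothesis lnA : local_noetherian.

(** By Nakayama's lemma, over a local ring this characterizes rows that form a minimal generating
    family of their span. *)
Definition row_minimal r n (D : 'M[A]_(r, n)) : Prop :=
  forall w, w *m D = 0 -> map_mx res w = 0 :> 'rV_r.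

(** A generating family of least size works: a coefficient with nonzero residue in a relation is a
    unit, and the corresponding row could be dropped. *)
Lemma minimal_generators n (Q : 'rV[A]_n -> Prop) : submodule Q ->
  exists r (D : 'M[A]_(r, n)), (forall v, Q v <-> row_span D v) /\ row_minimal D.
Proof.
case: lnA => nA _ uA Qsub.
pose P r := `[< exists D : 'M[A]_(r, n), forall v, Q v <-> row_span D v >].
have exP : exists r, P r.
  by have [r [D DP]] := noetherian_submodule nA Qsub; exists r; apply/asboolP; exists D.
case: (ex_minnP exP) => r /asboolP[D DP] rmin; exists r, D; split=> // w wD.
apply/rowP => i; rewrite !mxE; apply/eqP; apply: contraT => /uA[b bw].
case: r => [|r] in D DP rmin w wD i bw *; first by case: i bw.
suff /rmin : P r by rewrite ltnn.
apply/asboolP; exists (row' i D) => v; split; last first.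
  case=> u ->; apply/DP; exists (\row_j oapp (u 0) 0 (unlift i j)).
  apply/rowP => j; rewrite !mxE (bigD1_ord i) //= !mxE unlift_none mul0r add0r.
  by apply: eq_bigr => l _; rewrite !mxE liftK.
(* Subtracting a multiple of the relation [w] cancels coordinate [i] of [u] without changing
   [u *m D]. *)
case/DP => u ->; pose t := u - (u 0 i * b) *: w.
have ti : t 0 i = 0 by rewrite !mxE -mulrA bw mulr1 subrr.
have -> : u *m D = t *m D by rewrite mulmxBl -scalemxAl wD scaler0 subr0.
exists (col' i t); apply/rowP => j; rewrite !mxE (bigD1_ord i) //= ti mul0r add0r.
by apply: eq_bigr => l _; rewrite !mxE.
Qed.

(** Sigma types are used because the recursive construction of resolutions needs the matrices as
    data. *)
Lemma syzygies m n (D : 'M[A]_(m, n)) :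
  {r & {E : 'M[A]_(r, m) | (forall v, v *m D = 0 <-> row_span E v) /\ row_minimal E}}.
Proof.
have [|r /cid EP] := cid (minimal_generators (n := m) (Q := fun v => v *m D = 0) _).
  split=> [|a x y xD yD]; first by rewrite mul0mx.
  by rewrite mulmxDl -scalemxAl xD yD scaler0 addr0.
by exists r.
Qed.

Section Extension.
Variables (M : lmodType A) (r0 r1 r2 : nat).
Variables (augm : {linear 'rV[A]_r0 -> M}) (D0 : 'M[A]_(r1, r0)) (D1 : 'M[A]_(r2, r1)).
Hypothesis augm_surj : forall x, exists v, augm v = x.
Hypothesis exact0 : forall v, augm v = 0 <-> row_span D0 v.
Hypothesis exact1 : forall v, v *m D0 = 0 <-> row_span D1 v.

(** A differential bundled with its sizes. In [next] the number of columns is the previous number of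
    rows, so consecutive differentials compose without casts. *)
Let stage := {m : nat & {r : nat & 'M[A]_(r, m)}}.
Let next (s : stage) : stage :=
  existT _ (projT1 (projT2 s)) (existT (fun r => 'M[A]_(r, _))
    (projT1 (syzygies (projT2 (projT2 s))))
    (sval (projT2 (syzygies (projT2 (projT2 s)))))).
Let stages i : stage := iter i next (existT _ r1 (existT (fun r => 'M[A]_(r, _)) r2 D1)).
Let rank i := if i is j.+1 then projT1 (stages j) else r0.
Let diff i : 'M[A]_(rank i.+1, rank i) :=
  match i with 0 => D0 | j.+1 => projT2 (projT2 (stages j)) end.

Let exactS i (v : 'rV[A]_(rank i.+1)) : v *m diff i = 0 <-> exists w, v = w *m diff i.+1.
Proof.
case: i v => [|i] v; first exact: exact1.
exact: (svalP (projT2 (syzygies (projT2 (projT2 (stages i)))))).1.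
Qed.

Definition extend_resolution : free_resolution M :=
  @FreeResolution A M rank diff augm augm_surj exact0 exactS.

(** From the third differential on, each row is a relation among the rows of a [row_minimal] matrix,
    hence has residue 0; the first two are covered by the hypotheses. *)
Lemma extend_resolution_minimal : map_mx res D0 = 0 -> map_mx res D1 = 0 ->
  row_minimal D1 -> forall i, diff_res (A := A) extend_resolution i = 0.
Proof.
move=> D00 D10 D1min.
have rmin i : row_minimal (projT2 (projT2 (stages i))).
  by case: i => [|i] //; apply: (svalP (projT2 (syzygies _))).2.
case=> [|[|i]] //; apply/row_matrixP => j; rewrite row0 /diff_res -map_row.
apply: (rmin i); rewrite rowE.
by apply/(@exactS i.+1); exists (delta_mx 0 j).
Qed.

End Extension.
End LocalAlgebra.

(** The recursion carries two consecutive terms with their relation, since the existence of the next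
    term depends on that relation. *)
Lemma dependent_choice_seq (T : nat -> Type) (P : forall i, T i -> T i.+1 -> Prop)
    (x0 : T 0) (x1 : T 1) : P 0 x0 x1 ->
    (forall i x y, P i x y -> exists z, P i.+1 y z) ->
  exists f : forall i, T i, f 0 = x0 /\ forall i, P i (f i) (f i.+1).
Proof.
move=> P0 PS.
pose st i := {p : T i * T i.+1 | P i p.1 p.2}.
have /all_sig[next nextP] : forall s : {i & st i},
    {z | P (projT1 s).+1 (sval (projT2 s)).2 z}.
  by case=> i [[x y] /= Pxy]; apply/cid/(PS _ x).
pose fix f i : st i := match i with
  | 0 => exist (fun p => P 0 p.1 p.2) (x0, x1) P0
  | j.+1 => exist (fun p => P j.+1 p.1 p.2) ((sval (f j)).2, next (existT _ j (f j)))
                  (nextP (existT _ j (f j)))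
  end.
by exists (fun i => (sval (f i)).1); split=> // i; apply: (svalP (f i)).
Qed.

(** * Comparison maps and homotopies between free resolutions *)

Section Comparison.
Variables (A : comNzRingType) (M : lmodType A).
Implicit Types F G : free_resolution M.
Local Notation d := fr_diff.

Lemma fr_diffK F i : d F i.+1 *m d F i = 0.
Proof.
apply/row_matrixP => j; rewrite row0 row_mul; apply/fr_exactS.
by exists (delta_mx 0 j); rewrite rowE.
Qed.

Lemma augm_fr_diff F m (X : 'M_(m, _)) (j : 'I_m) :
  fr_augm F (row j (X *m d F 0)) = 0.
Proof. by apply/fr_exact0; exists (row j X); rewrite row_mul. Qed.

Lemma lift_exact0 F m (X : 'M_(m, fr_rank F 0)) :
  (forall j, fr_augm F (row j X) = 0) -> exists Y, X = Y *m d F 0.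
Proof.
move=> X0; have /choice[f fP] j : exists w, row j X = w *m d F 0.
  exact/fr_exact0.
by exists (\matrix_j f j); apply/row_matrixP => j; rewrite row_mul rowK.
Qed.

Lemma lift_exactS F m i (X : 'M_(m, fr_rank F i.+1)) :
  X *m d F i = 0 -> exists Y, X = Y *m d F i.+1.
Proof.
move=> X0; have /choice[f fP] j : exists w, row j X = w *m d F i.+1.
  by apply/fr_exactS; rewrite -row_mul X0 row0.
by exists (\matrix_j f j); apply/row_matrixP => j; rewrite row_mul rowK.
Qed.

(** The identity of [M] lifts in degree 0 because [F] is free there, then degree by degree by
    exactness of [G]. *)
Lemma chain_map F G : exists f : forall i, 'M_(fr_rank F i, fr_rank G i),
  (forall v, fr_augm G (v *m f 0) = fr_augm F v) /\
  forall i, f i.+1 *m d G i = d F i *m f i.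
Proof.
have /choice[g gP] j : exists v, fr_augm G v = fr_augm F (delta_mx 0 j).
  exact: fr_augm_surj.
pose f0 := \matrix_j g j.
have f0P v : fr_augm G (v *m f0) = fr_augm F v.
  rewrite mulmx_sum_row [v in RHS]row_sum_delta !linear_sum /=.
  by apply: eq_bigr => j _; rewrite !linearZ /= rowK gP.
have [|f1 f1P] := @lift_exact0 G _ (d F 0 *m f0).
  by move=> j; rewrite row_mul f0P -[d F 0]mul1mx augm_fr_diff.
have [|i x y xy|f [f0E fP]] := @dependent_choice_seq
    (fun i => 'M_(fr_rank F i, fr_rank G i))
    (fun i x y => y *m d G i = d F i *m x) f0 f1.
- by [].
- have [|z zP] := @lift_exactS G _ i (d F i.+1 *m y); last by exists z.
  by rewrite -mulmxA xy mulmxA fr_diffK mul0mx.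
- by exists f; rewrite f0E.
Qed.

(** To be applied to the difference between a round trip of comparison maps and the identity. *)
Lemma null_homotopy F (f : forall i, 'M_(fr_rank F i)) :
  (forall v, fr_augm F (v *m f 0) = 0) ->
  (forall i, f i.+1 *m d F i = d F i *m f i) ->
  exists h : forall i, 'M_(fr_rank F i, fr_rank F i.+1),
    f 0 = h 0 *m d F 0 /\
    forall i, f i.+1 = d F i *m h i + h i.+1 *m d F i.+1.
Proof.
move=> f0 fS; have [j|h0 h0P] := @lift_exact0 F _ (f 0).
  by rewrite rowE f0.
(* The hypothesis makes [f i.+1 - d F i *m h] a cycle, hence a boundary by exactness. *)
have step i h : d F i *m (h *m d F i) = d F i *m f i ->
    exists h', f i.+1 = d F i *m h + h' *m d F i.+1.
  move=> hP; have [|h' h'P] := @lift_exactS F _ i (f i.+1 - d F i *m h).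
    by rewrite mulmxBl -mulmxA fS hP subrr.
  by exists h'; rewrite -h'P addrC subrK.
have [|h1 h1P] := step 0 h0; first by rewrite -h0P.
have [i x y xy|h [h0E hP]] := @dependent_choice_seq
    (fun i => 'M_(fr_rank F i, fr_rank F i.+1))
    (fun i x y => f i.+1 = d F i *m x + y *m d F i.+1) h0 h1 h1P.
  apply: step.
  by rewrite xy mulmxDr [_ *m (_ *m x)]mulmxA fr_diffK mul0mx add0r.
by exists h; rewrite h0E.
Qed.

End Comparison.

(** * Independence of Betti numbers from the resolution *)

Section HomologyRank.
Variable k : fieldType.

(* The hypotheses say that g induces a surjection of Z' / B' onto Z / B. *)
Lemma homology_rank_le (p p' q q' n n' : nat) (Z : 'M[k]_(p, n)) (B : 'M_(q, n))
    (Z' : 'M_(p', n')) (B' : 'M_(q', n')) (g : 'M_(n', n)) :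
  (B <= Z)%MS -> (B' <= Z')%MS -> (B' *m g <= B)%MS -> (Z <= Z' *m g + B)%MS ->
  (\rank Z - \rank B <= \rank Z' - \rank B')%N.
Proof.
move=> BZ BZ' B'B ZB; pose W := (Z' :\: B')%MS.
have rW : (\rank W + \rank B' = \rank Z')%N.
  by have := mxrank_cap_compl Z' B'; rewrite (capmx_idPr BZ') addnC.
have /mxrankS rZ : (Z <= W *m g + B)%MS.
  apply: submx_trans ZB _; rewrite addsmx_sub addsmxSr andbT.
  have ZE : (Z' <= B' + W)%MS.
    by rewrite -{1}(addsmx_diff_cap_eq Z' B') addsmxC addsmxS ?capmxSr.
  apply: submx_trans (submxMr g ZE) _; rewrite addsmxMr addsmxC.
  by rewrite addsmxS.
rewrite -rW addnK leq_subLR.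
apply: leq_trans (leq_trans rZ (mxrank_adds_leqif _ _)) _.
by rewrite addnC leq_add2l mxrankM_maxl.
Qed.

End HomologyRank.

Section BettiResolution.
Variables (k : fieldType) (A : augRing k) (M : lmodType A).
Implicit Types F G : free_resolution M.
Local Notation d := (diff_res (A := A)).

(** The composite [f] then [g] is homotopic to the identity of [F], also after reduction to [k].
    Hence [g] induces a surjection from the homology of the reduced [G] onto that of the reduced
    [F]. *)
Lemma tor_dim_le F G i : (tor_dim (A := A) F i <= tor_dim (A := A) G i)%N.
Proof.
have [f [f0 fS]] := chain_map F G; have [g [g0 gS]] := chain_map G F.
have [|j|h [h0 hS]] := @null_homotopy _ _ F (fun j => f j *m g j - 1%:M).
- by move=> v; rewrite mulmxBr mulmx1 raddfB mulmxA /= g0 f0 subrr.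
- by rewrite mulmxBl mulmxBr mul1mx mulmx1 -mulmxA gS !mulmxA fS.
pose r (p q : nat) := @map_mx A k (residue A) p q.
have dd (H : free_resolution M) j : d H j.+1 *m d H j = 0.
  by rewrite /diff_res -map_mxM fr_diffK map_mx0.
have gr j : r _ _ (g j.+1) *m d F j = d G j *m r _ _ (g j).
  by rewrite /r /diff_res -!map_mxM gS.
have fr j : r _ _ (f j.+1) *m d G j = d F j *m r _ _ (f j).
  by rewrite /r /diff_res -!map_mxM fS.
have fgr j : r _ _ (f j) *m r _ _ (g j) - 1%:M = r _ _ (f j *m g j - 1%:M).
  by rewrite /r map_mxB map_mxM map_mx1.
case: i => [|i] /=.
  suff: (\rank (1%:M : 'M[k]_(fr_rank F 0)) - \rank (d F 0) <=
         \rank (1%:M : 'M[k]_(fr_rank G 0)) - \rank (d G 0))%N by rewrite !mxrank1.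
  apply: (homology_rank_le (g := r _ _ (g 0))); rewrite ?submx1 //.
    by rewrite -gr submxMl.
  rewrite -[X in (X <= _)%MS](subKr (r _ _ (f 0) *m r _ _ (g 0))) fgr h0.
  rewrite addmx_sub_adds ?mul1mx ?submxMl // /r map_mxM -mulNmx.
  exact: submxMl.
have sk (H : free_resolution M) : (d H i.+1 <= kermx (d H i))%MS.
  by apply/sub_kermxP; apply: dd.
apply: (homology_rank_le (g := r _ _ (g i.+1))); rewrite ?sk //.
  by rewrite -gr submxMl.
set Z := kermx (d F i).
(* A cycle is its image under the round trip minus a term that the homotopy shows to be a
   boundary. *)
rewrite -[X in (X <= _)%MS](subKr (Z *m (r _ _ (f i.+1) *m r _ _ (g i.+1)))).
rewrite addmx_sub_adds //.
  rewrite mulmxA submxMr //; apply/sub_kermxP.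
  by rewrite -mulmxA fr mulmxA mulmx_ker mul0mx.
rewrite -{2}[Z]mulmx1 -mulmxBr fgr hS /r map_mxD !map_mxM mulmxDr mulmxA.
by rewrite mulmx_ker mul0mx add0r mulmxA -mulNmx submxMl.
Qed.

(** Two resolutions bound each other's values, and [F] itself rules out the default of [xget]. *)
Lemma betti_tor_dim F i : betti A M i = tor_dim (A := A) F i.
Proof.
rewrite /betti; case: xgetP => [b _ [G ->]|/(_ (tor_dim (A := A) F i))].
  by apply/eqP; rewrite eqn_leq !tor_dim_le.
by case; exists F.
Qed.

Lemma betti_le_rank F i : (betti A M i <= fr_rank F i)%N.
Proof.
rewrite (betti_tor_dim F); case: i => [|i] /=; first exact: leq_subr.
by rewrite (leq_trans (leq_subr _ _)) ?rank_leq_col.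
Qed.

Lemma betti_minimal F i : (forall j, d F j = 0) -> betti A M i = fr_rank F i.
Proof.
move=> F0; rewrite (betti_tor_dim F); case: i => [|i] /=.
  by rewrite F0 mxrank0 subn0.
by rewrite mxrank_ker !F0 !mxrank0 !subn0.
Qed.

End BettiResolution.

(* M is A / Q; an ideal Q is given as a submodule of A^1. *)
Definition cyclic_quotient (A : comNzRingType) (Q : 'rV[A]_1 -> Prop)
    (M : lmodType A) : Prop :=
  exists e : M, (forall x, exists a, x = a *: e) /\
    forall v : 'rV_1, v 0 0 *: e = 0 <-> Q v.

(** * Betti numbers of cyclic modules and the embedding dimension *)

Section CyclicModules.
Variables (k : fieldType) (A : augRing k).
Hypothesis lnA : local_noetherian A.
Local Notation res := (residue A).

(** Minimality enters only as a premise of the last clause: arbitrary presentations thus give upper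
    bounds on Betti numbers, and minimal ones their values. *)
Lemma presented_resolution (Q : 'rV[A]_1 -> Prop) (M : lmodType A) r1 r2
    (D0 : 'M[A]_(r1, 1)) (D1 : 'M[A]_(r2, r1)) :
  cyclic_quotient Q M -> (forall v, Q v <-> row_span D0 v) ->
  (forall v, v *m D0 = 0 <-> row_span D1 v) ->
  exists F : free_resolution M, [/\ fr_rank F 0 = 1%N, fr_rank F 1 = r1,
    fr_rank F 2 = r2 &
    map_mx res D0 = 0 -> map_mx res D1 = 0 -> row_minimal D1 ->
    forall i, diff_res (A := A) F i = 0].
Proof.
move=> [e [e_gen e_ann]] D0P D1P; pose augm (v : 'rV[A]_1) : M := v 0 0 *: e.
have augm_lin : linear augm by move=> a x y; rewrite /augm !mxE scalerDl scalerA.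
pose augmL : {linear 'rV[A]_1 -> M} :=
  HB.pack augm (GRing.isLinear.Build _ _ _ _ augm augm_lin).
have augm_surj x : exists v, augmL v = x.
  by have [a ->] := e_gen x; exists a%:M; rewrite /= /augm !mxE mulr1n.
have augm0 v : augmL v = 0 <-> row_span D0 v.
  exact: iff_trans (e_ann v) (D0P v).
exists (extend_resolution lnA augm_surj augm0 D1P); split=> //.
exact: extend_resolution_minimal.
Qed.

Lemma betti_presented_le (Q : 'rV[A]_1 -> Prop) (M : lmodType A) r1 r2
    (D0 : 'M[A]_(r1, 1)) (D1 : 'M[A]_(r2, r1)) :
  cyclic_quotient Q M -> (forall v, Q v <-> row_span D0 v) ->
  (forall v, v *m D0 = 0 <-> row_span D1 v) ->
  (betti A M 1 <= r1)%N /\ (betti A M 2 <= r2)%N.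
Proof.
move=> QM D0P D1P; have [F [_ F1 F2 _]] := presented_resolution QM D0P D1P.
by split; [rewrite -F1|rewrite -F2]; apply: betti_le_rank.
Qed.

(** The ranks are chosen before [M], so all models of the quotient by [Q] are seen to share the same
    Betti numbers. *)
Lemma minimal_presentation (Q : 'rV[A]_1 -> Prop) : submodule Q ->
  (forall v, Q v -> res (v 0 0) = 0) ->
  exists r1 r2 (D0 : 'M[A]_(r1, 1)) (D1 : 'M[A]_(r2, r1)),
    [/\ forall v, Q v <-> row_span D0 v, row_minimal D0,
        forall v, v *m D0 = 0 <-> row_span D1 v &
        forall M : lmodType A, cyclic_quotient Q M ->
          [/\ betti A M 0 = 1%N, betti A M 1 = r1 & betti A M 2 = r2]].
Proof.
move=> Qsub Qm; have [r1 [D0 [D0P D0min]]] := minimal_generators lnA Qsub.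
have [r2 [D1 [D1P D1min]]] := syzygies lnA D0.
exists r1, r2, D0, D1; split=> // M QM.
have [F [F0 F1 F2 Fmin]] := presented_resolution QM D0P D1P.
have {}Fmin : forall i, diff_res (A := A) F i = 0.
  apply: Fmin => //; apply/row_matrixP => i; rewrite row0 -map_row.
    apply/rowP => j; rewrite ord1 mxE [RHS]mxE; apply: Qm; apply/D0P.
    by exists (delta_mx 0 i); rewrite rowE.
  by apply: D0min; apply/D1P; exists (delta_mx 0 i); rewrite rowE.
by split; rewrite (betti_minimal _ Fmin).
Qed.

Definition max_ideal (v : 'rV[A]_1) : Prop := res (v 0 0) = 0.

Lemma max_ideal_submodule : submodule max_ideal.
Proof.
split=> [|a x y]; first by rewrite /max_ideal mxE rmorph0.
by rewrite /max_ideal !mxE rmorphD rmorphM /= => -> ->; rewrite mulr0 addr0.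
Qed.

Lemma in_max_sqD (u w : A) : in_max_sq u -> in_max_sq w -> in_max_sq (u + w).
Proof.
move=> [r [a [b [ab ->]]]] [r' [a' [b' [ab' ->]]]].
pose glue (f : 'I_r -> A) (f' : 'I_r' -> A) (i : 'I_(r + r')) :=
  match fintype.split i with inl j => f j | inr j => f' j end.
exists (r + r')%N, (glue a a'), (glue b b'); split=> [i|].
  by rewrite /glue; case: (fintype.split i).
rewrite big_split_ord /=; congr (_ + _); apply: eq_bigr => i _; rewrite /glue.
  by rewrite -[lshift r' i]/(unsplit (inl i)) unsplitK.
by rewrite -[rshift r i]/(unsplit (inr i)) unsplitK.
Qed.

Lemma in_max_sqMl (a u : A) : in_max_sq u -> in_max_sq (a * u).
Proof.
move=> [r [b [c [bc ->]]]]; exists r, (fun i => a * b i), c; split=> [i|].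
  by case: (bc i) => b0 c0; split; rewrite // /in_max rmorphM /= b0 mulr0.
by rewrite mulr_sumr; apply: eq_bigr => i _; rewrite mulrA.
Qed.

(** Each family is expressed through the other modulo the square of the maximal ideal. Independence
    of [v] makes the product of the two residue matrices the identity, and ranks are compared. *)
Lemma cotangent_basis_le d d' (v : 'I_d -> A) (v' : 'I_d' -> A) :
  cotangent_basis v -> cotangent_basis v' -> (d <= d')%N.
Proof.
move=> [v_max v_gen v_free] [v'_max v'_gen _].
have /choice[P PP] i := v'_gen _ (v_max i).
have /choice[Q QP] j := v_gen _ (v'_max j).
pose p : 'M_(d, d') := \matrix_(i, j) res (P i j).
pose q : 'M_(d', d) := \matrix_(j, l) res (Q j l).
suff pq : p *m q = 1%:M.
  rewrite -(mxrank1 k d) -pq (leq_trans (mxrankM_maxr _ _)) //.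
  exact: rank_leq_row.
apply/matrixP => i l; rewrite !mxE.
have /v_free/(_ l) : in_max_sq (\sum_l ((i == l)%:R - \sum_j P i j * Q j l) * v l).
  have -> : \sum_l ((i == l)%:R - \sum_j P i j * Q j l) * v l =
      (v i - \sum_j P i j * v' j) + \sum_j P i j * (v' j - \sum_l Q j l * v l).
    have vE : \sum_l (i == l)%:R * v l = v i.
      rewrite (bigD1 i) //= eqxx mul1r big1 ?addr0 // => j /negPf ji.
      by rewrite eq_sym ji mul0r.
    under eq_bigr do rewrite mulrBl.
    rewrite sumrB vE.
    under [X in _ = _ + X]eq_bigr do rewrite mulrBr.
    rewrite sumrB addrA subrK; congr (_ - _).
    under eq_bigr do rewrite mulr_suml.
    rewrite exchange_big; apply: eq_bigr => j _ /=.
    by rewrite mulr_sumr; apply: eq_bigr => m _; rewrite mulrA.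
  apply: in_max_sqD => //; elim/big_ind: _ => [|x y|j _].
  - by exists 0%N, (fun=> 0), (fun=> 0); split; [case|rewrite big_ord0].
  - exact: in_max_sqD.
  - exact: in_max_sqMl.
move=> /eqP; rewrite rmorphB rmorph_nat subr_eq0 => /eqP ->.
by rewrite rmorph_sum; apply: eq_bigr => j _; rewrite !mxE rmorphM.
Qed.

(** Both sides count a minimal generating family of the maximal ideal, whose classes form a basis of
    the cotangent space. *)
Lemma edim_betti (M : lmodType A) :
  cyclic_quotient max_ideal M -> edim A = betti A M 1.
Proof.
have [//|r1 [r2 [D0 [D1 [D0P D0min _ MP]]]] /MP[_ -> _]] :=
  minimal_presentation max_ideal_submodule.
have D0b : cotangent_basis (fun i => D0 i 0).
  have spanP (u : A) : in_max u -> exists w : 'rV_r1, u = \sum_i w 0 i * D0 i 0.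
    move=> um; have /D0P[w uE] : max_ideal u%:M by rewrite /max_ideal mxE mulr1n.
    by exists w; have /rowP/(_ 0) := uE; rewrite !mxE mulr1n.
  split.
  - move=> i; have : max_ideal (row i D0).
      by apply/D0P; exists (delta_mx 0 i); rewrite rowE.
    by rewrite /max_ideal mxE.
  - move=> u /spanP[w ->]; exists (w 0); rewrite subrr.
    by exists 0%N, (fun=> 0), (fun=> 0); split; [case|rewrite big_ord0].
  - move=> c [r [a [b [ab cE]]]] i.
    have /choice[w wP] j : exists w : 'rV_r1, b j = \sum_i w 0 i * D0 i 0.
      by apply: spanP; have [] := ab j.
    (* Writing each [b j] in the generators turns membership in the square into an exact relation,
       to which minimality applies. The subtracted terms have residue 0 because the [a j] do. *)
    have /D0min/rowP/(_ i) : (\row_i (c i - \sum_j a j * w j 0 i)) *m D0 = 0.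
      apply/rowP => j; rewrite ord1 !mxE.
      rewrite (eq_bigr (fun i => c i * D0 i 0 - \sum_j a j * (w j 0 i * D0 i 0))).
        rewrite sumrB cE exchange_big /= -sumrB big1 // => l _.
        by rewrite wP -mulr_sumr subrr.
      move=> l _; rewrite mxE mulrBl mulr_suml; congr (_ - _).
      by apply: eq_bigr => l' _; rewrite mulrA.
    rewrite !mxE rmorphB /= rmorph_sum big1 ?subr0 // => j _.
    by rewrite rmorphM /= (ab j).1 mul0r.
rewrite /edim; apply: xget_unique; first by exists (fun i => D0 i 0).
move=> d [v vb]; apply/eqP; rewrite eqn_leq.
by rewrite (cotangent_basis_le vb D0b) (cotangent_basis_le D0b vb).
Qed.

End CyclicModules.

(** * Fiber products *)

Definition kernel (A B : comNzRingType) (h : {rmorphism A -> B}) (v : 'rV[A]_1) : Prop :=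
  h (v 0 0) = 0.

Lemma kernel_submodule (A B : comNzRingType) (h : {rmorphism A -> B}) :
  submodule (kernel h).
Proof.
split=> [|a x y]; first by rewrite /kernel mxE rmorph0.
by rewrite /kernel !mxE rmorphD rmorphM /= => -> ->; rewrite mulr0 addr0.
Qed.

Lemma cyclic_quotient_pull (A B : comNzRingType) (h : {rmorphism A -> B}) :
  (forall b, exists a, h a = b) -> cyclic_quotient (kernel h) (pull_module h).
Proof.
move=> hS; exists (1 : B); split=> [x|v].
  have [a ax] := hS x; exists a; rewrite -ax.
  by rewrite -[RHS]/(h a * 1) mulr1.
by rewrite -[_ *: _]/(h (v 0 0) * 1) mulr1.
Qed.

Lemma cyclic_quotient_ext (A : comNzRingType) (Q Q' : 'rV[A]_1 -> Prop) (M : lmodType A) :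
  (forall v, Q v <-> Q' v) -> cyclic_quotient Q M -> cyclic_quotient Q' M.
Proof.
move=> QQ' [e [e_gen e_ann]]; exists e; split=> // v.
exact: iff_trans (e_ann v) (QQ' v).
Qed.

Lemma quot_map_eq0 (A : comNzRingType) (I : idealr A) a :
  quot_map I a = 0 <-> a \in I.
Proof.
rewrite -(rmorph0 (quot_map I)) /quot_map.
have := Quotient.idealrBE I a 0; rewrite subr0 => ->.
by split=> [->|/eqP].
Qed.

Lemma quot_map_surj (A : comNzRingType) (I : idealr A) x : exists a, quot_map I a = x.
Proof. by exists (repr x); rewrite /quot_map reprK. Qed.

Lemma cyclic_quotient_quot (A : comNzRingType) (I : idealr A) :
  cyclic_quotient (fun v : 'rV_1 => v 0 0 \in I) (quot_module I).
Proof.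
apply: cyclic_quotient_ext (cyclic_quotient_pull (@quot_map_surj _ I)) => v.
exact: quot_map_eq0.
Qed.

Lemma cyclic_quotient_restr (A B : comNzRingType) (h : {rmorphism A -> B})
    (Q : 'rV[B]_1 -> Prop) (M : lmodType B) : (forall b, exists a, h a = b) ->
  cyclic_quotient Q M -> cyclic_quotient (fun v => Q (map_mx h v)) (restr h M).
Proof.
move=> hS [e [e_gen e_ann]]; exists e; split=> [x|v].
  have [b ->] := e_gen x; have [a <-] := hS b.
  by exists a.
by rewrite -e_ann mxE.
Qed.

(** * Presentations over a fiber product, given abstractly by its two projections *)

Section FiberProduct.
Variables (k : fieldType) (A V : augRing k) (B K : comNzRingType).
Variables (p1 : {rmorphism V -> A}) (p2 : {rmorphism V -> B}).
Variables (a : {rmorphism A -> K}) (b : {rmorphism B -> K}).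
Hypotheses (lnA : local_noetherian A) (lnV : local_noetherian V).
Hypothesis p1_surj : forall s, exists w, p1 w = s.
Hypothesis pE : forall w, a (p1 w) = b (p2 w).
Hypothesis p_inj : forall w w', p1 w = p1 w' -> p2 w = p2 w' -> w = w'.
Hypothesis p_fiber : forall s t, a s = b t -> exists w, p1 w = s /\ p2 w = t.
Hypothesis a_local : forall s, a s = 0 -> residue A s = 0.
Hypothesis residueE : forall w, residue V w = residue A (p1 w).

Let mx_inj m n (X Y : 'M[V]_(m, n)) :
  map_mx p1 X = map_mx p1 Y -> map_mx p2 X = map_mx p2 Y -> X = Y.
Proof.
move=> /matrixP E1 /matrixP E2; apply/matrixP => i j.
by apply: p_inj; [have := E1 i j|have := E2 i j]; rewrite !mxE.
Qed.

Let lift1 m n (X : 'M[A]_(m, n)) : exists Y, map_mx p1 Y = X.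
Proof.
have /choice[f fP] (ij : 'I_m * 'I_n) : exists w, p1 w = X ij.1 ij.2.
  exact: p1_surj.
by exists (\matrix_(i, j) f (i, j)); apply/matrixP => i j; rewrite !mxE fP.
Qed.

(** This realizes the kernel of [a] inside [V] as the kernel of [p2]. *)
Let lift0 m (X : 'M[A]_(m, 1)) : (forall i, a (X i 0) = 0) ->
  exists Y, map_mx p1 Y = X /\ map_mx p2 Y = 0.
Proof.
move=> X0; have /choice[f fP] i : exists w, p1 w = X i 0 /\ p2 w = 0.
  by apply: p_fiber; rewrite X0 rmorph0.
exists (\matrix_(i, _) f i); split; apply/matrixP => i j; rewrite !mxE ?ord1.
  exact: (fP i).1.
exact: (fP i).2.
Qed.

(** The kernel of [p2] is the kernel of [a] with [V] acting through [p1]. Its relations over [V] are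
    therefore lifts of relations over [A], together with all vectors whose entries lie in the kernel
    of [p1]; the latter account for the [r1 * g] extra rows. *)
Lemma fiber_second_presentation r1 r2 g (D0 : 'M[A]_(r1, 1)) (D1 : 'M_(r2, r1))
    (C0 : 'M[V]_(g, 1)) :
  (forall v, kernel a v <-> row_span D0 v) ->
  (forall v, v *m D0 = 0 <-> row_span D1 v) ->
  (forall v, kernel p1 v <-> row_span C0 v) ->
  exists (E0 : 'M[V]_(r1, 1)) (E1 : 'M_(r2 + r1 * g, r1)),
    (forall v, kernel p2 v <-> row_span E0 v) /\
    (forall v, v *m E0 = 0 <-> row_span E1 v).
Proof.
move=> D0P D1P C0P.
have [|E0 [E01 E02]] := @lift0 _ D0.
  move=> i; have : kernel a (row i D0).
    by apply/D0P; exists (delta_mx 0 i); rewrite rowE.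
  by rewrite /kernel mxE.
have [S SE] := lift1 D1.
(* The vector [w] stores an [r1] by [g] matrix of coefficients; its product with [C0] is a general
   vector with entries in the kernel of [p1]. *)
pose tensor (w : 'rV[V]_(r1 * g)) : 'rV_r1 := (vec_mx w *m C0)^T.
have tensor_lin : linear tensor.
  by move=> c x y; rewrite /tensor linearP mulmxDl -scalemxAl linearP.
pose tensorL : {linear 'rV[V]_(r1 * g) -> 'rV[V]_r1} :=
  HB.pack tensor (GRing.isLinear.Build _ _ _ _ tensor tensor_lin).
exists E0, (col_mx S (lin1_mx tensorL)).
have C01 : map_mx p1 C0 = 0.
  apply/matrixP => i j; rewrite ord1 !mxE.
  have : kernel p1 (row i C0) by apply/C0P; exists (delta_mx 0 i); rewrite rowE.
  by rewrite /kernel mxE.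
have E0eq0 v : v *m E0 = 0 <-> map_mx p1 v *m D0 = 0.
  rewrite -E01 -map_mxM; split=> [->|vE]; first by rewrite map_mx0.
  by apply: mx_inj; rewrite ?vE map_mx0 // map_mxM E02 mulmx0.
split=> v; split.
- rewrite /kernel => v2; have /D0P[w wE] : kernel a (map_mx p1 v).
    by rewrite /kernel mxE pE v2 rmorph0.
  have [W WE] := lift1 w; exists W; apply: mx_inj; rewrite map_mxM.
    by rewrite WE E01.
  by rewrite E02 mulmx0; apply/rowP => i; rewrite ord1 !mxE.
- case=> w ->; rewrite /kernel.
  have -> : p2 ((w *m E0) 0 0) = map_mx p2 (w *m E0) 0 0 by rewrite [RHS]mxE.
  by rewrite map_mxM E02 mulmx0 mxE.
- move=> /E0eq0/D1P[c cE]; have [W WE] := lift1 c.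
  (* Once the lifted relation is subtracted, all entries lie in the kernel of [p1], which [C0]
     spans. *)
  have /choice[f fP] j : exists w, ((v - W *m S) 0 j)%:M = w *m C0.
    apply/C0P; rewrite /kernel [X in p1 X]mxE mulr1n.
    have -> : p1 ((v - W *m S) 0 j) = map_mx p1 (v - W *m S) 0 j by rewrite [RHS]mxE.
    by rewrite map_mxB map_mxM WE SE -cE subrr mxE.
  exists (row_mx W (mxvec (\matrix_j f j))).
  rewrite mul_row_col mul_rV_lin1 /= /tensor mxvecK.
  rewrite -[LHS](subrKC (W *m S)); congr (_ + _).
  apply/rowP => j; rewrite [RHS]mxE.
  have -> : (\matrix_j f j *m C0) j 0 = (row j (\matrix_j f j *m C0)) 0 0.
    by rewrite [RHS]mxE.
  by rewrite row_mul rowK -fP [RHS]mxE mulr1n.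
- case=> w ->; rewrite -[w]hsubmxK mul_row_col mul_rV_lin1 /= /tensor.
  apply/E0eq0; rewrite map_mxD -map_trmx !map_mxM C01 mulmx0 trmx0 addr0 SE.
  by apply/D1P; exists (map_mx p1 (lsubmx w)).
Qed.

(** The kernel of [V -> K] is the direct sum of the kernels of [p1] and [p2], so generators and
    relations are simply juxtaposed. *)
Lemma fiber_base_presentation g1 g2 h1 h2 (C0 : 'M[V]_(g1, 1)) (C1 : 'M_(g2, g1))
    (E0 : 'M[V]_(h1, 1)) (E1 : 'M_(h2, h1)) :
  (forall v, kernel p1 v <-> row_span C0 v) ->
  (forall v, v *m C0 = 0 <-> row_span C1 v) ->
  (forall v, kernel p2 v <-> row_span E0 v) ->
  (forall v, v *m E0 = 0 <-> row_span E1 v) ->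
  (forall v, kernel (a \o p1 : {rmorphism V -> K}) v <-> row_span (col_mx C0 E0) v) /\
  (forall v, v *m col_mx C0 E0 = 0 <-> row_span (block_mx C1 0 0 E1) v).
Proof.
move=> C0P C1P E0P E1P; split=> v; split.
- rewrite /kernel /= => av.
  have [|x [x1 x2]] := p_fiber (s := p1 (v 0 0)) (t := 0).
    by rewrite av rmorph0.
  have /E0P[w wE] : kernel p2 x%:M by rewrite /kernel mxE mulr1n.
  have /C0P[u uE] : kernel p1 (v - x%:M).
    by rewrite /kernel !mxE mulr1n rmorphB /= x1 subrr.
  by exists (row_mx u w); rewrite mul_row_col -wE -uE subrK.
- case=> w ->; rewrite -[w]hsubmxK mul_row_col /kernel /= mxE !rmorphD /=.
  have -> : p1 ((lsubmx w *m C0) 0 0) = 0 by apply/C0P; exists (lsubmx w).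
  rewrite rmorph0 add0r pE.
  have -> : p2 ((rsubmx w *m E0) 0 0) = 0 by apply/E0P; exists (rsubmx w).
  by rewrite rmorph0.
- rewrite -[v]hsubmxK mul_row_col => /eqP; rewrite addr_eq0 => /eqP vE.
  (* The two halves are opposite elements of kernels that meet in 0, so each vanishes and the
     relation splits. *)
  have k1 : kernel p1 (lsubmx v *m C0) by apply/C0P; exists (lsubmx v).
  have k2 : kernel p2 (rsubmx v *m E0) by apply/E0P; exists (rsubmx v).
  have v0 : lsubmx v *m C0 = 0.
    apply/rowP => i; rewrite ord1 [RHS]mxE; apply: p_inj; rewrite rmorph0 //.
    by rewrite vE mxE rmorphN /= k2 oppr0.
  have v0' : rsubmx v *m E0 = 0 by apply/eqP; rewrite -oppr_eq0 -vE v0.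
  have /C1P[u uE] := v0; have /E1P[w wE] := v0'.
  by exists (row_mx u w); rewrite mul_row_block !mulmx0 addr0 add0r -uE -wE.
- case=> w ->; rewrite -[w]hsubmxK mul_row_block !mulmx0 addr0 add0r mul_row_col.
  have -> : lsubmx w *m C1 *m C0 = 0 by apply/C1P; exists (lsubmx w).
  have -> : rsubmx w *m E1 *m E0 = 0 by apply/E1P; exists (rsubmx w).
  by rewrite addr0.
Qed.

(** The last hypothesis is the degree 2 part of largeness applied to [K]. It turns the upper bound
    from the juxtaposed presentation into a lower bound for [betti V MB 2]. *)
Lemma betti_fiber (MA MB MK : lmodType V) (NK : lmodType A) :
  cyclic_quotient (kernel p1) MA -> cyclic_quotient (kernel p2) MB ->
  cyclic_quotient (kernel (a \o p1 : {rmorphism V -> K})) MK ->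
  cyclic_quotient (kernel a) NK ->
  betti V MK 2 =
    (betti A NK 2 + betti A NK 1 * betti V MA 1 + betti V MA 2)%N ->
  betti V MB 1 = betti A NK 1 /\
  betti V MB 2 = (betti A NK 2 + betti A NK 1 * betti V MA 1)%N.
Proof.
move=> qA qB qK qNK.
have kerA v : kernel a v -> residue A (v 0 0) = 0 by apply: a_local.
have ker1 v : kernel p1 v -> residue V (v 0 0) = 0.
  by rewrite /kernel residueE => ->; rewrite rmorph0.
have ker2 v : kernel p2 v -> residue V (v 0 0) = 0.
  by rewrite /kernel residueE => v0; apply: a_local; rewrite pE v0 rmorph0.
have [r1 [r2 [D0 [D1 [D0P D0min D1P /(_ _ qNK)[_ nk1 nk2]]]]]] :=
  minimal_presentation lnA (kernel_submodule a) kerA.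
have [g1 [g2 [C0 [C1 [C0P C0min C1P /(_ _ qA)[_ -> ->]]]]]] :=
  minimal_presentation lnV (kernel_submodule p1) ker1.
have [h1 [h2 [E0 [E1 [E0P E0min E1P /(_ _ qB)[_ h1E h2E]]]]]] :=
  minimal_presentation lnV (kernel_submodule p2) ker2.
have [F0 [F1 [F0P F1P]]] := fiber_second_presentation D0P D1P C0P.
have [le1 le2] := betti_presented_le lnV qB F0P F1P.
have [G0P G1P] := fiber_base_presentation C0P C1P E0P E1P.
have [_ leK] := betti_presented_le lnV qK G0P G1P.
(* Cancelling [g2] leaves the lower bound [r2 + r1 * g1]; the matching upper bound is [le2]. *)
rewrite nk1 nk2 => KE; rewrite KE addnC leq_add2l -h2E in leK.
split; last by apply/eqP; rewrite eqn_leq le2.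
apply/eqP; rewrite eqn_leq le1 h1E /=.
(* Conversely to [le1], generators of the kernel of [p2] map under [p1] to generators of the kernel
   of [a], whence [r1 <= h1]. *)
have D0'P v : kernel a v <-> row_span (map_mx p1 E0) v.
  split=> [av|[w ->]].
    have [|x [x1 x2]] := p_fiber (s := v 0 0) (t := 0); first by rewrite av rmorph0.
    have /E0P[w wE] : kernel p2 x%:M by rewrite /kernel mxE mulr1n.
    exists (map_mx p1 w); rewrite -map_mxM -wE.
    by apply/rowP => i; rewrite ord1 !mxE mulr1n.
  have [W <-] := lift1 w; rewrite -map_mxM /kernel mxE pE.
  by have /E0P -> : row_span E0 (W *m E0); [exists W|rewrite rmorph0].
have [s [S [SP _]]] := syzygies lnA (map_mx p1 E0).
by have [+ _] := betti_presented_le lnA qNK D0'P SP; rewrite nk1.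
Qed.

Lemma betti1_kernel_gt0 (NK : lmodType A) : cyclic_quotient (kernel a) NK ->
  (exists2 s, s != 0 & a s = 0) -> (0 < betti A NK 1)%N.
Proof.
move=> qNK [s s0 as0].
have [r1 [r2 [D0 [D1 [D0P _ _ /(_ _ qNK)[_ -> _]]]]]] :=
  minimal_presentation lnA (kernel_submodule a) (fun v => @a_local (v 0 0)).
rewrite lt0n; apply: contraNneq s0 => r10; move: D0 D1 D0P; rewrite r10 => D0 _ D0P.
have /D0P[w /rowP/(_ 0)] : kernel a s%:M by rewrite /kernel mxE mulr1n.
by rewrite mxE mulr1n mxE big_ord0 => ->.
Qed.

End FiberProduct.

(** An ideal [Q] is generated by lifts of generators of its image in [A] and of generators of the
    image in [B] of its part killed by [p1]. That part embeds in [B] by joint injectivity. *)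
Lemma noetherian_fiber (V A B : comNzRingType)
    (p1 : {rmorphism V -> A}) (p2 : {rmorphism V -> B}) :
  (forall s, exists w, p1 w = s) -> (forall t, exists w, p2 w = t) ->
  (forall w, p1 w = 0 -> p2 w = 0 -> w = 0) ->
  noetherian A -> noetherian B -> noetherian V.
Proof.
move=> p1S p2S p_inj nA nB Q [Q0 QD].
have QE (x y : 'rV[V]_1) c : Q x -> Q y -> Q (c *: x + y) by apply: QD.
pose Q1 (x : 'rV[A]_1) := exists w, Q w /\ map_mx p1 w = x.
pose Q2 (y : 'rV[B]_1) := exists w, [/\ Q w, map_mx p1 w = 0 & map_mx p2 w = y].
have [|r1 [D DP]] := nA Q1.
  split; first by exists 0; rewrite map_mx0.
  move=> s x y [w [Qw <-]] [w' [Qw' <-]]; have [c <-] := p1S s.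
  by exists (c *: w + w'); split; [exact: QD|rewrite map_mxD map_mxZ].
have [|r2 [E EP]] := nB Q2.
  split; first by exists 0; rewrite !map_mx0.
  move=> s x y [w [Qw w0 <-]] [w' [Qw' w'0 <-]]; have [c <-] := p2S s.
  exists (c *: w + w'); split; first exact: QD.
    by rewrite map_mxD map_mxZ w0 w'0 scaler0 addr0.
  by rewrite map_mxD map_mxZ.
have /choice[f fP] i : Q1 (row i D) by apply/DP; exists (delta_mx 0 i); rewrite rowE.
have /choice[g gP] i : Q2 (row i E) by apply/EP; exists (delta_mx 0 i); rewrite rowE.
pose F := \matrix_i f i; pose G := \matrix_i g i.
have F1 : map_mx p1 F = D.
  by apply/row_matrixP => i; rewrite -map_row rowK (fP i).2.
have G1 : map_mx p1 G = 0.
  by apply/row_matrixP => i; rewrite -map_row rowK row0; case: (gP i).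
have G2 : map_mx p2 G = E.
  by apply/row_matrixP => i; rewrite -map_row rowK; case: (gP i).
have spanQ r (H : 'M[V]_(r, 1)) : (forall i, Q (row i H)) -> forall w, Q (w *m H).
  exact: submodule_mulmx.
have QF i : Q (row i F) by rewrite rowK; exact: (fP i).1.
have QG i : Q (row i G) by rewrite rowK; case: (gP i).
have liftrow (C : comNzRingType) (p : {rmorphism V -> C}) r (w : 'rV[C]_r) :
    (forall s, exists x, p x = s) -> exists W, map_mx p W = w.
  move=> pS; have /choice[h hP] j : exists x, p x = w 0 j by apply: pS.
  by exists (\row_j h j); apply/rowP => j; rewrite !mxE hP.
exists (r1 + r2)%N, (col_mx F G) => v; split=> [Qv|[w ->]]; last first.
  rewrite -[w]hsubmxK mul_row_col -[_ *m F]scale1r.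
  by apply: QD; apply: spanQ.
have /DP[w wE] : Q1 (map_mx p1 v) by exists v.
have [W WE] := liftrow _ p1 _ w p1S.
have /EP[u uE] : Q2 (map_mx p2 (v - W *m F)).
  exists (v - W *m F); split=> //; last first.
    by rewrite map_mxB map_mxM WE F1 -wE subrr.
  by rewrite addrC -scaleN1r; apply: QD => //; apply: spanQ.
have [U UE] := liftrow _ p2 _ u p2S.
exists (row_mx W U); rewrite mul_row_col -[v](subrKC (W *m F)); congr (_ + _).
apply/eqP; rewrite -subr_eq0; apply/eqP/rowP => i; rewrite ord1 [RHS]mxE.
have entry (C : comNzRingType) (p : {rmorphism V -> C}) (M : 'rV[V]_1) :
  p (M 0 0) = map_mx p M 0 0 by rewrite [RHS]mxE.
apply: p_inj; rewrite entry.
  by rewrite map_mxB map_mxB !map_mxM WE F1 -wE subrr G1 mulmx0 subr0 mxE.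
by rewrite map_mxB uE map_mxM UE G2 subrr mxE.
Qed.

Lemma local_noetherian_fiber (k : fieldType) (V A B : augRing k) (K : comNzRingType)
    (p1 : {rmorphism V -> A}) (p2 : {rmorphism V -> B})
    (a : {rmorphism A -> K}) (b : {rmorphism B -> K}) :
  local_noetherian A -> local_noetherian B ->
  (forall s, exists w, p1 w = s) -> (forall t, exists w, p2 w = t) ->
  (forall w, a (p1 w) = b (p2 w)) ->
  (forall w w', p1 w = p1 w' -> p2 w = p2 w' -> w = w') ->
  (forall s t, a s = b t -> exists w, p1 w = s /\ p2 w = t) ->
  (forall w, residue V w = residue A (p1 w)) ->
  (forall w, residue V w = residue B (p2 w)) -> local_noetherian V.
Proof.
move=> [nA sA uA] [nB _ uB] p1S p2S pE p_inj p_fib res1 res2; split.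
- apply: (noetherian_fiber p1S p2S _ nA nB) => w w1 w2.
  by apply: p_inj; rewrite ?w1 ?w2 rmorph0.
- move=> c; have [s <-] := sA c; have [w <-] := p1S s.
  by exists w; rewrite res1.
- move=> w w0; have [s sE] : exists s, s * p1 w = 1 by apply: uA; rewrite -res1.
  have [t tE] : exists t, t * p2 w = 1 by apply: uB; rewrite -res2.
  (* Both [a s] and [b t] invert the common image of [w] in [K], hence they agree and the inverses
     glue. *)
  have /p_fib[x [xs xt]] : a s = b t.
    rewrite -[LHS]mulr1 -(rmorph1 b) -tE mulrC rmorphM -mulrA.
    by rewrite -pE -rmorphM [p1 w * s]mulrC sE rmorph1 mulr1.
  by exists x; apply: p_inj; rewrite rmorphM rmorph1 ?xs ?xt.
Qed.

Lemma fiber_inj (A B K : comNzRingType) (a : {rmorphism A -> K})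
    (b : {rmorphism B -> K}) (p q : fiber a b) :
  proj1 p = proj1 q -> proj2 p = proj2 q -> p = q.
Proof. by move=> E1 E2; apply: val_inj; apply: injective_projections. Qed.

Section KernelIdeal.
Variables (A B : comNzRingType) (h : {rmorphism A -> B}).

Definition kernel_pred : {pred A} := fun s => h s == 0.

Lemma kernel_pred_idealr : idealr_closed kernel_pred.
Proof.
split=> [| |s x y]; rewrite !unfold_in ?rmorph0 ?rmorph1 ?oner_eq0 //.
by move=> /eqP hx /eqP hy; rewrite rmorphD rmorphM /= hx hy mulr0 addr0.
Qed.

HB.instance Definition _ := isIdealr.Build A kernel_pred kernel_pred_idealr.

Definition kernel_ideal : idealr A := kernel_pred.

Lemma kernel_idealP s : s \in kernel_ideal <-> h s = 0.
Proof. by split=> [/eqP|hs]; [|apply/eqP]. Qed.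

(** This is what allows [large] to be applied to the kernel of a map onto a reduced ring. *)
Lemma radical_kernel_ideal :
  (forall (t : B) r, t ^+ r = 0 -> t = 0) -> radical kernel_ideal.
Proof. by move=> Bred s r /kernel_idealP; rewrite rmorphXn => /Bred/kernel_idealP. Qed.

End KernelIdeal.

(** * Division of convergent power series *)

Fixpoint prime_seq (i : nat) : nat :=
  s2val (prime_above (if i is j.+1 then prime_seq j else 0)).

Lemma prime_seq_prime i : prime (prime_seq i).
Proof. by case: i => [|i] /=; case: prime_above. Qed.

Lemma prime_seq_inj : injective prime_seq.
Proof.
have lt i j : (i < j)%N -> (prime_seq i < prime_seq j)%N.
  by apply: (homo_ltn ltn_trans) => {}i /=; case: prime_above.
by move=> i j ij; case: (ltngtP i j) => // /lt; rewrite ij ltnn.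
Qed.

(** * A monomial order and Dickson's lemma *)

Section Codes.
Variable n : nat.
Local Notation mindex := {ffun 'I_n -> nat}.

Definition code (m : mindex) : nat := (\prod_(i < n) prime_seq i ^ m i)%N.

Lemma code_gt0 m : (0 < code m)%N.
Proof. by apply: prodn_gt0 => i; rewrite expn_gt0 prime_gt0 ?prime_seq_prime. Qed.

Lemma codeD m m' : code (m + m') = (code m * code m')%N.
Proof.
by rewrite /code -big_split; apply: eq_bigr => i _; rewrite ffunE expnD.
Qed.

Lemma code0 : code 0 = 1%N.
Proof. by rewrite /code big1 // => i _; rewrite ffunE. Qed.

(** Unique factorization: the valuation of the code at the prime of index [i] recovers the exponent
    [m i]. *)
Lemma code_inj : injective code.
Proof.
have pos (m : mindex) (j : 'I_n) : (0 < prime_seq j ^ m j)%N.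
  by rewrite expn_gt0 prime_gt0 ?prime_seq_prime.
have logn_code (m : mindex) (i : 'I_n) : logn (prime_seq i) (code m) = m i.
  have rest_gt0 : (0 < \prod_(j < n | j != i) prime_seq j ^ m j)%N.
    exact: prodn_cond_gt0.
  rewrite /code (bigD1 i) //= lognM // pfactorK ?prime_seq_prime //.
  rewrite [X in (_ + X)%N]lognE prime_seq_prime rest_gt0 /=.
  case: ifP => [|_]; last by rewrite addn0.
  rewrite Euclid_dvd_prod ?prime_seq_prime // big_has_cond => /hasP[j _ /andP[ji]].
  rewrite Euclid_dvdX ?prime_seq_prime // dvdn_prime2 ?prime_seq_prime // => /andP[/eqP].
  by move=> /prime_seq_inj/val_inj ij; rewrite ij eqxx in ji.
by move=> m m' mm'; apply/ffunP => i; rewrite -!logn_code mm'.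
Qed.

Definition mle (e m : mindex) : bool := [forall i, (e i <= m i)%N].

Lemma mleP e m : reflect (exists k, m = k + e) (mle e m).
Proof.
apply: (iffP forallP) => [em|[k ->] i]; last by rewrite ffunE leq_addl.
exists (mindex_sub m e); apply/ffunP => i.
by rewrite !ffunE; rewrite -[LHS](subnK (em i)).
Qed.

Lemma mindex_subK (k e : mindex) : mindex_sub (k + e) e = k.
Proof. by apply/ffunP => i; rewrite !ffunE; exact: addnK. Qed.

Lemma code_gt1 (m : mindex) : m != 0 -> (1 < code m)%N.
Proof.
move=> m0; rewrite ltn_neqAle code_gt0 andbT; apply: contra m0 => /eqP.
by rewrite -code0 => /code_inj <-.
Qed.

(** Induction on the number [d] of coordinates compared. A finite set [s] for the first [d]
    coordinates also serves every exponent whose next coordinate is at least the maximum over [s];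
    the others lie in finitely many slices where that coordinate is constant. *)
Lemma dickson (E : mindex -> Prop) : exists s : seq mindex,
  (forall e, e \in s -> E e) /\ forall m, E m -> exists2 e, e \in s & mle e m.
Proof.
suff D d : forall E : mindex -> Prop, exists s : seq mindex,
    (forall e, e \in s -> E e) /\
    forall m, E m -> exists2 e, e \in s & forall i : 'I_n, (i < d)%N -> (e i <= m i)%N.
  have [s [sE sP]] := D n E; exists s; split=> // m /sP[e es em].
  by exists e => //; apply/forallP => i; apply: em.
elim: d => [|d IHd] {}E.
  have [[m Em]|E0] := pselect (exists m, E m).
    exists [:: m]; split=> [e|m' _]; first by rewrite inE => /eqP ->.
    by exists m; rewrite ?mem_head.
  by exists [::]; split=> // m Em; case: E0; exists m.
have [nd|dn] := leqP n d.
  have [s [sE sP]] := IHd E; exists s; split=> // m /sP[e es em].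
  by exists e => // i _; apply: em; exact: leq_trans (ltn_ord i) nd.
pose o := Ordinal dn; have [s [sE sP]] := IHd E.
have slices b : exists s' : seq mindex, (forall e, e \in s' -> E e) /\
    forall m, E m -> (m o < b)%N -> exists2 e, e \in s' &
      forall i : 'I_n, (i < d.+1)%N -> (e i <= m i)%N.
  elim: b => [|b [s1 [s1E s1P]]]; first by exists [::]; split.
  have [s2 [s2E s2P]] := IHd (fun m => E m /\ m o = b).
  exists (s1 ++ s2); split=> [e|m Em].
    by rewrite mem_cat => /orP[/s1E|/s2E[]].
  rewrite ltnS leq_eqVlt => /orP[/eqP mb|/(s1P _ Em)[e es em]]; last first.
    by exists e; rewrite // mem_cat es.
  have [|e es em] := s2P m; first by [].
  exists e; first by rewrite mem_cat es orbT.
  move=> i; rewrite ltnS leq_eqVlt => /orP[/eqP id|/em//].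
  by rewrite (_ : i = o) ?mb ?(s2E e es).2 //; apply: val_inj.
have [s' [s'E s'P]] := slices (\max_(e <- s) e o).
exists (s ++ s'); split=> [e|m Em].
  by rewrite mem_cat => /orP[/sE|/s'E].
have [/(s'P _ Em)[e es em]|mo] := ltnP (m o) (\max_(e <- s) e o).
  by exists e; rewrite // mem_cat es orbT.
have [e es em] := sP m Em; exists e; first by rewrite mem_cat es.
move=> i; rewrite ltnS leq_eqVlt => /orP[/eqP id|/em//].
rewrite (_ : i = o); last exact: val_inj.
by apply: leq_trans mo; rewrite (big_rem e) //= leq_maxl.
Qed.

End Codes.

(** * Weighted norms of power series *)

Section Division.
Variables (R : realType) (n : nat).
Local Notation C := (Cx R).
Local Notation mindex := {ffun 'I_n -> nat}.
Local Notation box N := {ffun 'I_n -> 'I_N.+1}.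
Implicit Types (a b g : mindex -> C) (m e : mindex) (t s N : nat).

Definition radii t : 'rV[C]_n := \row_i (prime_seq i)%:R ^- t.

(* On the polydisc of radii p_i^-t the monomial z^m has size (code m)^-t. *)
Lemma mon_radii t m : mon (radii t) m = (code m)%:R ^- t.
Proof.
rewrite /mon /code natr_prod -prodrXl -prodfV; apply: eq_bigr => i _.
by rewrite mxE natrX exprVn -!exprM mulnC.
Qed.

(** An upper bound for the l^1 norm on the polydisc of radii [radii t], phrased by partial sums so
    that no limit is involved. *)
Definition norm_le t a (M : C) : Prop :=
  forall N, psum (fun m => `|a m|) (radii t) N <= M.

Definition convergent a : Prop := exists t M, norm_le t a M.

Lemma mon_radii_ge0 t m : 0 <= mon (radii t) m.
Proof. by rewrite mon_radii invr_ge0 exprn_ge0. Qed.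

Lemma norm_le_ge0 t a M : norm_le t a M -> 0 <= M.
Proof.
move=> aM; apply: le_trans (aM 0%N); apply: sumr_ge0 => k _.
by rewrite mulr_ge0 // mon_radii_ge0.
Qed.

Lemma norm_le_dom t t' a b (M c : C) : 0 <= c ->
  (forall m, `|b m| * mon (radii t') m <= c * (`|a m| * mon (radii t) m)) ->
  norm_le t a M -> norm_le t' b (c * M).
Proof.
move=> c0 ab aM N; apply: le_trans (ler_wpM2l c0 (aM N)).
by rewrite mulr_sumr; apply: ler_sum => k _.
Qed.

(** Codes are at least 1, so a larger [t] means a smaller polydisc. *)
Lemma norm_leW t t' a M : (t <= t')%N -> norm_le t a M -> norm_le t' a M.
Proof.
move=> tt' aM; rewrite -[M]mul1r; apply: norm_le_dom aM => // m.
rewrite mul1r ler_wpM2l // !mon_radii lef_pV2 ?posrE ?exprn_gt0 ?ltr0n ?code_gt0 //.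
by rewrite ler_weXn2l // ler1n code_gt0.
Qed.

Lemma norm_le_le t a M L : M <= L -> norm_le t a M -> norm_le t a L.
Proof. by move=> ML aM N; apply: le_trans (aM N) ML. Qed.

Lemma norm_leD t a b M L : norm_le t a M -> norm_le t b L ->
  norm_le t (fun m => a m + b m) (M + L).
Proof.
move=> aM bL N; apply: le_trans (lerD (aM N) (bL N)).
rewrite -big_split; apply: ler_sum => k _ /=.
by rewrite -mulrDl ler_wpM2r ?mon_radii_ge0 ?ler_normD.
Qed.

Lemma norm_le0 t : norm_le t (fun=> 0) 0.
Proof.
by move=> N; rewrite /psum big1 // => k _; rewrite normr0 mul0r.
Qed.

Lemma norm_le_sum t r (a : 'I_r -> mindex -> C) (M : C) :
  (forall j, norm_le t (a j) M) -> norm_le t (fun m => \sum_j a j m) (M *+ r).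
Proof.
elim: r a => [|r IHr] a aM.
  by move=> N; rewrite /psum big1 // => k _; rewrite big_ord0 normr0 mul0r.
have := norm_leD (aM ord0) (IHr (fun j => a (lift ord0 j)) (fun j => aM _)).
rewrite -mulrS; congr norm_le.
by apply/funext => m; rewrite big_ord_recl.
Qed.

(** The terms of a partial sum of the Cauchy product are among those of the product of the partial
    sums. *)
Lemma norm_le_conv t a b M L : norm_le t a M -> norm_le t b L ->
  norm_le t (conv a b) (M * L).
Proof.
move=> aM bL N; have aM0 := norm_le_ge0 aM.
apply: (@le_trans _ _ (psum (conv (fun m => `|a m|) (fun m => `|b m|)) (radii t) N)).
  apply: ler_sum => k _; rewrite ler_wpM2r ?mon_radii_ge0 //.
  apply: le_trans (ler_norm_sum _ _ _) _.
  by apply: ler_sum => l _; rewrite normrM.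
have psum0 (c : mindex -> C) : 0 <= psum (fun m => `|c m|) (radii t) N.
  by apply: sumr_ge0 => k _; rewrite mulr_ge0 // mon_radii_ge0.
apply: (le_trans _ (ler_pM (psum0 a) (psum0 b) (aM N) (bL N))).
rewrite psum_conv {2}/psum big_distrl /=; apply: ler_sum => k _.
rewrite big_distrr /= [leRHS](bigID (add_le k)) /= lerDl.
by apply: sumr_ge0 => l _; rewrite !mulr_ge0 // mon_radii_ge0.
Qed.

Lemma box_shift_le (D : numDomainType) (F : mindex -> D) e N N' :
  (forall i, N + e i <= N')%N -> (forall m, 0 <= F m) ->
  \sum_(k : box N) F (box_val k + e) <= \sum_(k : box N') F (box_val k).
Proof.
move=> NN' F0; pose up (k : box N) : box N' := [ffun i => inord (k i + e i)].
have upE (k : box N) i : up k i = (k i + e i)%N :> nat.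
  by rewrite ffunE inordK // ltnS (leq_trans _ (NN' i)) // leq_add2r leq_ord.
have up_inj : injective up.
  move=> k l kl; apply/ffunP => i; apply: val_inj.
  by have := upE k i; rewrite kl upE => /addIn.
have -> : \sum_(k : box N) F (box_val k + e) = \sum_(k : box N) F (box_val (up k)).
  apply: eq_bigr => k _; congr F; apply/ffunP => i.
  by rewrite [LHS]ffunE !(ffunE (fun _ => nat_of_ord _)) upE.
rewrite -(big_imset (fun k => F (box_val k)) (in2W up_inj)) /=.
rewrite [leRHS](bigID (mem [set up k | k in xpredT])) /= lerDl.
exact: sumr_ge0.
Qed.

(** Dividing by [z^e] costs at most the inverse of the size of [z^e] on the polydisc. *)
Lemma norm_le_shift t a e M :
  norm_le t a M -> norm_le t (fun m => a (m + e)) (M * (code e)%:R ^+ t).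
Proof.
move=> aM N; pose F m := `|a m| * mon (radii t) m.
have F0 m : 0 <= F m by rewrite mulr_ge0 // mon_radii_ge0.
have -> : psum (fun m => `|a (m + e)|) (radii t) N =
    (\sum_(k : box N) F (box_val k + e)) * (code e)%:R ^+ t.
  rewrite /psum mulr_suml; apply: eq_bigr => k _.
  rewrite /F -mulrA; congr (_ * _); rewrite !mon_radii codeD natrM exprMn invfM.
  by rewrite mulfVK // expf_neq0 // pnatr_eq0 -lt0n code_gt0.
rewrite ler_wpM2r ?exprn_ge0 //.
apply: le_trans (box_shift_le (N' := (N + \sum_i e i)%N) _ F0) (aM _) => i.
by rewrite leq_add2l (bigD1 i) //= leq_addr.
Qed.

(** As in a local monomial order, the leading exponent has the smallest code; its coefficient is
    normalized to 1. *)
Definition leading a e : Prop :=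
  a e = 1 /\ forall m, m != e -> a m != 0 -> (code e < code m)%N.

Lemma exists_leading a : (exists m, a m != 0) ->
  exists2 e, a e != 0 & leading (fun m => (a e)^-1 * a m) e.
Proof.
case=> m0 am0; pose P c := `[< exists2 m, code m = c & a m != 0 >].
have exP : exists c, P c by exists (code m0); apply/asboolP; exists m0.
case: (ex_minnP exP) => c /asboolP[e <- ae] emin; exists e => //; split.
  by rewrite mulVf.
move=> m me; rewrite mulf_eq0 negb_or => /andP[_ am].
rewrite ltn_neqAle (contra_neq (@code_inj n _ _)) 1?eq_sym //=.
by apply: emin; apply/asboolP; exists m.
Qed.

Definition tail a e : mindex -> C := fun m => if m == e then 0 else a m.

(** The first two terms of the binomial expansion give [2 * c^c <= (c+1)^c], so every [c] factors
    contribute at most one half. *)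
Lemma ratio_small (c : nat) (e : C) : (0 < c)%N -> 0 < e ->
  exists s0, forall s, (s0 <= s)%N -> (c%:R / c.+1%:R) ^+ s < e.
Proof.
move=> c0 e0; have [N0 N0P] := half_expn_small e0.
exists (c * N0)%N => s sN; apply: le_lt_trans (N0P _ (leqnn N0)).
have c1 : 0 <= c%:R / c.+1%:R :> C by rewrite divr_ge0.
apply: (@le_trans _ _ ((c%:R / c.+1%:R) ^+ (c * N0))).
  by rewrite ler_wiXn2l // ler_pdivrMr ?ltr0n // mul1r ler_nat.
rewrite exprM lerXn2r ?nnegrE ?exprn_ge0 ?invr_ge0 //.
rewrite expr_div_n -[2^-1]mul1r ler_pdivrMr ?exprn_gt0 ?ltr0n // mulrAC.
rewrite ler_pdivlMr ?ltr0n // mul1r -!natrX -natrM ler_nat.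
case: c c0 {c1 sN} => // c _; rewrite -[c.+2]addn1 expnDn.
rewrite 2!big_ord_recl /= !bin0 bin1 !mul1n !exp1n !muln1 subn0 subn1 /=.
by rewrite addnA -expnS muln2 -addnn leq_addr.
Qed.

(** Exponents in the tail have code at least [c + 1]. Raising [t] by [s] shrinks them by [(c+1)^-s]
    or more, against exactly [c^-s] for the leading monomial. *)
Lemma tail_small a e t0 M (eps : C) : 0 < eps -> leading a e -> norm_le t0 a M ->
  exists t1, forall t, (t1 <= t)%N -> norm_le t (tail a e) (eps * (code e)%:R ^- t).
Proof.
move=> eps0 [_ aP] aM; have M0 := norm_le_ge0 aM.
pose c := code e; have c0 : (0 < c)%N := code_gt0 e.
have cC : 0 < c%:R :> C by rewrite ltr0n.
(* The summand 1 keeps this divisor positive even when [M] is 0. *)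
have d0 : 0 < M * c%:R ^+ t0 + 1 by rewrite ltr_wpDl // mulr_ge0 // exprn_ge0.
have [s0 s0P] := ratio_small c0 (divr_gt0 eps0 d0).
exists (t0 + s0)%N => t tt; have tE : t = (t0 + (t - t0))%N.
  by rewrite subnKC // (leq_trans (leq_addr _ _) tt).
have /s0P : (s0 <= t - t0)%N by rewrite leq_subRL // (leq_trans (leq_addr _ _) tt).
move: (t - t0)%N tE => s -> {t tt} small.
apply: (@norm_le_le _ _ (c.+1%:R ^- s * M)).
  rewrite exprD invfM mulrA ler_pdivlMr ?exprn_gt0 // ler_pdivlMr ?exprn_gt0 //.
  move: small; rewrite expr_div_n ltr_pdivlMr // => /ltW; apply: le_trans.
  rewrite [leRHS]mulrC mulrDl mul1r -[X in X <= _]addr0 lerD //; last first.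
    by rewrite divr_ge0 ?exprn_ge0.
  by rewrite le_eqVlt; apply/orP; left; apply/eqP; ring.
apply: norm_le_dom aM => [|m]; first by rewrite invr_ge0 exprn_ge0.
rewrite /tail; case: (eqVneq m e) => [_|me].
  by rewrite normr0 mul0r mulr_ge0 ?mulr_ge0 ?invr_ge0 ?exprn_ge0 // mon_radii_ge0.
have [->|am] := eqVneq (a m) 0; first by rewrite normr0 !mul0r mulr0.
rewrite mulrCA ler_wpM2l // !mon_radii exprD invfM mulrC.
rewrite ler_wpM2r ?invr_ge0 ?exprn_ge0 //.
rewrite lef_pV2 ?posrE ?exprn_gt0 ?ltr0n ?code_gt0 // lerXn2r ?nnegrE //.
by rewrite ler_nat; exact: aP.
Qed.

End Division.

(** * Division with remainder by several series *)

Section DivisionTheorem.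
Variables (R : realType) (n : nat).
Local Notation C := (Cx R).
Local Notation mindex := {ffun 'I_n -> nat}.
Local Notation box N := {ffun 'I_n -> 'I_N.+1}.
Implicit Types (a b g G : mindex -> C) (m e : mindex).

Lemma sub_box m N (k : box N) (km : box_le k m) :
  m = mindex_sub m (box_val k) + box_val k.
Proof.
apply/ffunP => i; move/forallP: km => /(_ i) ki.
by rewrite !ffunE; rewrite -[LHS](subnK ki).
Qed.

Lemma conv_local a a' b m :
  (forall k, mle k m -> b (mindex_sub m k) != 0 -> a k = a' k) ->
  conv a b m = conv a' b m.
Proof.
move=> aa'; apply: eq_bigr => k km.
have [->|bk] := eqVneq (b (mindex_sub m (box_val k))) 0; first by rewrite !mulr0.
rewrite (aa' (box_val k)) //; apply/mleP.
by exists (mindex_sub m (box_val k)); exact: sub_box.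
Qed.

Lemma conv_monomial a e m :
  conv a (fun m => (m == e)%:R) m = if mle e m then a (mindex_sub m e) else 0.
Proof.
have kE N (k : box N) : box_le k m -> mindex_sub m (box_val k) == e ->
    m = e + box_val k.
  by move=> km /eqP <-; exact: sub_box.
case: ifPn => [/mleP[k0 mE]|em]; last first.
  rewrite /conv big1 // => k km; case: eqVneq => [ke|]; last by rewrite mulr0.
  case/negP: em; apply/mleP; exists (box_val k); rewrite addrC.
  by apply: kE => //; apply/eqP.
pose N := (\sum_i m i)%N.
have k0N i : (k0 i < N.+1)%N.
  by rewrite ltnS /N (bigD1 i) //= mE ffunE -addnA leq_addr.
pose k : box N := [ffun i => Ordinal (k0N i)].
have kv : box_val k = k0 by apply/ffunP => i; rewrite !ffunE.
rewrite /conv (bigD1 k) /=; last first.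
  by apply/forallP => i; rewrite ffunE /= mE ffunE leq_addr.
have mk : mindex_sub m k0 = e by rewrite mE addrC mindex_subK.
have -> : mindex_sub m e = k0 by rewrite mE mindex_subK.
rewrite kv mk eqxx mulr1 big1 ?addr0 // => l /andP[lm lk].
case: eqVneq => [le|_]; last by rewrite mulr0.
case/eqP: lk; have lv : box_val l = k0.
  by rewrite -(mindex_subK (box_val l) e) addrC -(kE _ _ lm) ?le // mE mindex_subK.
apply/ffunP => i; apply: val_inj; have /ffunP/(_ i) := lv; rewrite -kv.
by rewrite !(ffunE (fun _ => nat_of_ord _)).
Qed.

Variables (r : nat) (f : 'I_r -> mindex -> C) (e : 'I_r -> mindex).
Hypothesis f_lead : forall j, leading (f j) (e j).

(** Each exponent is charged to at most one divisor, so that [G] is the sum of the [z^(e j)] times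
    [quot j G] and of [rem G]. *)
Let sel m : option 'I_r := [pick j | mle (e j) m].
Let quot j G : mindex -> C := fun k => if sel (k + e j) == Some j then G (k + e j) else 0.
Let rem G : mindex -> C := fun m => if sel m is None then G m else 0.
(** The error made when every [z^(e j)] in this decomposition is replaced by [f j]. *)
Let step G : mindex -> C := fun m => - \sum_j conv (quot j G) (tail (f j) (e j)) m.

(** Multiplication by a tail strictly raises codes relative to the leading monomial it replaces. *)
Let step_local G G' m :
  (forall m', (code m' < code m)%N -> G m' = G' m') -> step G m = step G' m.
Proof.
move=> GG'; congr (- _); apply: eq_bigr => j _; apply: conv_local => k /mleP[l mE].
rewrite mE mindex_subK /tail; case: (eqVneq l (e j)) => [_|lj]; first by rewrite eqxx.
move=> fl; rewrite /quot GG' // codeD mE codeD mulnC ltn_pmul2r ?code_gt0 //.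
exact: (f_lead j).2.
Qed.

(** Valid for every [G]; a solution of [G = g + step G] thus yields the division of [g]. *)
Let step_rem G m :
  G m - step G m = \sum_j conv (quot j G) (f j) m + rem G m.
Proof.
have convE j : conv (quot j G) (f j) m =
    (if sel m == Some j then G m else 0) + conv (quot j G) (tail (f j) (e j)) m.
  have -> : (if sel m == Some j then G m else 0) =
      conv (quot j G) (fun m => (m == e j)%:R) m.
    rewrite conv_monomial; case: mleP => [[k ->]|em].
      by rewrite mindex_subK.
    case: eqP => // selm; case: em; apply/mleP; move: selm; rewrite /sel.
    by case: pickP => // i em [<-].
  rewrite /conv -big_split; apply: eq_bigr => k _ /=; rewrite -mulrDr; congr (_ * _).
  by rewrite /tail; case: eqVneq => [->|_]; rewrite ?(f_lead j).1 ?addr0 ?add0r.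
under eq_bigr do rewrite convE.
rewrite big_split /= opprK addrAC; congr (_ + _).
rewrite /rem; case: (sel m) => [i|]; last first.
  by rewrite big1 ?add0r // => j _.
rewrite (bigD1 i) //= eqxx big1 ?addr0 // => j ji.
by case: eqP => // -[ij]; rewrite ij eqxx in ji.
Qed.

(** The loss [code (e j) ^ t] of the shift cancels against the bound on the tail, and [r] terms of
    weight [1 / (2 (r + 1))] add up to at most one half. *)
Let step_norm t G M : norm_le t G M ->
  (forall j, norm_le t (tail (f j) (e j)) ((2 * r.+1%:R)^-1 * (code (e j))%:R ^- t)) ->
  norm_le t (step G) (M / 2).
Proof.
move=> GM fM; have M0 := norm_le_ge0 GM.
have qM j : norm_le t (quot j G) (M * (code (e j))%:R ^+ t).
  rewrite -[X in norm_le _ _ X]mul1r; apply: norm_le_dom (norm_le_shift (e j) GM) => // m.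
  rewrite mul1r ler_wpM2r ?mon_radii_ge0 // /quot.
  by case: ifP => // _; rewrite normr0.
have cM j : norm_le t (conv (quot j G) (tail (f j) (e j))) (M * (2 * r.+1%:R)^-1).
  have := norm_le_conv (qM j) (fM j); congr norm_le.
  by rewrite mulrACA mulfV ?mulr1 // expf_neq0 // pnatr_eq0 -lt0n code_gt0.
have := norm_le_sum cM; move=> sM; rewrite -[M / 2]mul1r.
have {}sM : norm_le t (fun m => \sum_j conv (quot j G) (tail (f j) (e j)) m) (M / 2).
  apply: (norm_le_le _ sM); rewrite -mulrnAr ler_wpM2l // invfM -mulrnAr.
  rewrite ler_piMr ?invr_ge0 //.
  by rewrite -mulr_natr mulrC ler_pdivrMr ?ltr0n // mul1r ler_nat.
apply: norm_le_dom sM => // m; rewrite mul1r ler_wpM2r ?mon_radii_ge0 //.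
by rewrite /step normrN.
Qed.

Lemma weierstrass_division g : (forall j, convergent (f j)) -> convergent g ->
  exists (q : 'I_r -> mindex -> C) (h : mindex -> C),
    [/\ forall j, convergent (q j), convergent h,
        forall m, g m = \sum_j conv (q j) (f j) m + h m
      & forall j m, mle (e j) m -> h m = 0].
Proof.
move=> f_cvg [t0 [M gM]].
(* The sum of all thresholds dominates each of them, so one [t] serves every divisor. *)
have [t [tt0 ft]] : exists t, (t0 <= t)%N /\ forall j,
    norm_le t (tail (f j) (e j)) ((2 * r.+1%:R)^-1 * (code (e j))%:R ^- t).
  have /choice[t1 t1P] j : exists t1, forall t, (t1 <= t)%N ->
      norm_le t (tail (f j) (e j)) ((2 * r.+1%:R)^-1 * (code (e j))%:R ^- t).
    have [t2 [L fL]] := f_cvg j; apply: tail_small (f_lead j) fL.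
    by rewrite invr_gt0 mulr_gt0 ?ltr0n.
  exists (t0 + \sum_j t1 j)%N; split=> [|j]; first exact: leq_addr.
  by apply: t1P; rewrite (bigD1 j) //= addnCA leq_addr.
have {}gM := norm_leW tt0 gM.
(* The quotients are read off the solution G of G = g + step G: step raises
   codes, so the iteration is stationary at each exponent, and step halves
   the norm, so G converges. *)
pose Gs N := iter N (fun G m => g m + step G m) (fun=> 0).
have Gs_norm N : norm_le t (Gs N) (M *+ 2).
  elim: N => [|N IHN]; first apply: (norm_le_le _ (@norm_le0 _ _ t)).
    by rewrite mulrn_wge0 // (norm_le_ge0 gM).
  have := norm_leD gM (step_norm IHN ft).
  by rewrite -[M *+ 2]mulr_natr mulfK ?pnatr_eq0 // mulr_natr mulr2n.
have Gs_stable N m : (code m <= N)%N -> Gs N.+1 m = Gs N m.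
  elim: N m => [|N IHN] m; first by rewrite leqNgt code_gt0.
  move=> mN; congr (_ + _); apply: step_local => m' mm'.
  by apply: IHN; rewrite -ltnS (leq_trans mm').
pose G m := Gs (code m) m.
have GE N m : (code m <= N)%N -> Gs N m = G m.
  move=> /subnKC <-; elim: (N - code m)%N => [|d IHd]; first by rewrite addn0.
  by rewrite addnS Gs_stable ?leq_addr.
have G_fix m : G m = g m + step G m.
  rewrite -(GE (code m).+1) //; congr (_ + _); apply: step_local => m' mm'.
  exact/GE/ltnW.
(* On a given box, the iterate indexed by the sum of its codes already agrees with [G], so the
   uniform bound on iterates passes to [G]. *)
have G_norm : norm_le t G (M *+ 2).
  move=> N; apply: le_trans (Gs_norm (\sum_(k : box N) code (box_val k))%N N).
  apply: ler_sum => k _; rewrite GE //.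
  by rewrite (bigD1 k) //= leq_addr.
have conv_norm h : (forall m, `|h m| <= `|G m|) -> convergent h.
  move=> hG; exists t, (1 * (M *+ 2)); apply: norm_le_dom G_norm => // m.
  by rewrite mul1r ler_wpM2r // mon_radii_ge0.
exists (fun j => quot j G), (rem G); split.
- move=> j; exists t, (1 * (M *+ 2 * (code (e j))%:R ^+ t)).
  apply: norm_le_dom (norm_le_shift (e j) G_norm) => // m.
  rewrite mul1r ler_wpM2r ?mon_radii_ge0 // /quot.
  by case: ifP => // _; rewrite normr0.
- by apply: conv_norm => m; rewrite /rem; case: (sel m) => // _; rewrite normr0.
- by move=> m; rewrite -step_rem {1}G_fix addrK.
- move=> j m em; rewrite /rem /sel; case: pickP => // /(_ j).
  by rewrite em.
Qed.

End DivisionTheorem.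

(** * Germs of analytic functions *)

Section Expansions.
Local Open Scope classical_set_scope.
Variables (R : realType) (n : nat).
Local Notation C := (Cx R).
Local Notation mindex := {ffun 'I_n -> nat}.
Local Notation box N := {ffun 'I_n -> 'I_N.+1}.
Implicit Types (a b : mindex -> C) (m : mindex) (x h : 'rV[C]_n).

Lemma cvg_real_complex (u : R^nat) (l : R) :
  u @ \oo --> l -> (fun N => (u N)%:C%C : C) @ \oo --> (l%:C%C : C).
Proof.
move=> ul; apply/cvgrPdist_lt => e e0.
have eE : e = (complex.Re e)%:C%C by rewrite complex.RRe_real // gtr0_real.
have e0' : 0 < complex.Re e by move: e0; rewrite {1}eE -[0]/((0 : R)%:C)%C complex.ltcR.
move/cvgrPdist_lt : ul => /(_ _ e0'); apply: filterS => N uN.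
rewrite eE -rmorphB complex.normc_def /= expr0n /= addr0 sqrtr_sqr.
by rewrite complex.ltcR.
Qed.

(** Write [F] as [(F + G) - G]: both series have nonnegative terms and bounded partial sums, so
    monotone convergence applies. *)
Lemma box_sum_cvg (F G : mindex -> R) (M : R) :
  (forall m, `|F m| <= G m) ->
  (forall N, \sum_(k : box N) G (box_val k) <= M) ->
  cvg ((fun N => \sum_(k : box N) F (box_val k)) @ \oo).
Proof.
move=> FG GM.
have pos_cvg (H : mindex -> R) : (forall m, 0 <= H m <= G m *+ 2) ->
    cvg ((fun N => \sum_(k : box N) H (box_val k)) @ \oo).
  move=> HG; apply: nondecreasing_is_cvgn.
    move=> N N' NN'; have := @box_shift_le n R H 0 N N'.
    under eq_bigr do rewrite addr0.
    apply=> [i|m]; first by rewrite ffunE addn0.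
    by case/andP: (HG m).
  exists (M *+ 2) => _ [N _ <-].
  apply: (@le_trans _ _ ((\sum_(k : box N) G (box_val k)) *+ 2)).
    by rewrite -sumrMnl; apply: ler_sum => k _; case/andP: (HG (box_val k)).
  by rewrite lerMn2r GM orbT.
have G0 m : 0 <= G m by apply: le_trans (FG m).
have cG := pos_cvg G; have cFG := pos_cvg (fun m => F m + G m).
have -> : (fun N => \sum_(k : box N) F (box_val k)) =
    (fun N => \sum_(k : box N) (F (box_val k) + G (box_val k)) -
              \sum_(k : box N) G (box_val k)).
  by apply/funext => N; rewrite big_split /= addrK.
apply: is_cvgB.
  apply: cFG => m; have := FG m; rewrite ler_norml => /andP[? ?].
  by rewrite mulr2n lerD2r -lerBlDr sub0r; apply/andP.
by apply: cG => m; rewrite G0 mulr2n lerDl G0.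
Qed.

Lemma Re_le (z w : R[i]) : z <= w -> complex.Re z <= complex.Re w.
Proof. by rewrite complex.lecE => /andP[]. Qed.

(** Real and imaginary parts are treated separately, each dominated by the real majorant series. *)
Lemma psum_cvg a (r M : C) h :
  (forall N, psum (fun m => `|a m|) (const_mx r) N <= M) ->
  (forall i, `|h 0 i| <= r) -> exists l : C, psum a h N @[N --> \oo] --> l.
Proof.
move=> aM hr; pose c m : R[i] := a m * mon h m.
pose d m : R[i] := `|a m| * mon (const_mx r : 'rV[C]_n) m.
have cd m : `|c m| <= d m.
  rewrite normrM ler_wpM2l // normr_prod; apply: ler_prod => i _.
  rewrite normr_ge0 normrX mxE lerXn2r ?nnegrE //.
  exact: le_trans (hr i).
have dM N : \sum_(k : box N) complex.Re (d (box_val k)) <= complex.Re (M : R[i]).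
  apply: le_trans (Re_le (aM N)); rewrite /psum.
  by rewrite (big_morph (@complex.Re R) (id1 := 0) (op1 := +%R)) // => -[? ?] [].
have Re_d m : `|complex.Re (c m)| <= complex.Re (d m).
  by have := Re_le (le_trans (complex.normc_ge_Re (c m)) (cd m)).
have Im_d m : `|complex.Im (c m)| <= complex.Re (d m).
  have -> : complex.Im (c m) = complex.Re (- (('i)%C * c m)).
    by case: (c m) => u v /=; rewrite mul0r mul1r sub0r opprK.
  apply: (Re_le (le_trans (complex.normc_ge_Re _) _)).
  rewrite normrN normrM (_ : `|'i%C| = 1) ?mul1r //.
  by rewrite complex.normc_def /= expr0n /= add0r expr1n sqrtr1.
have /cvg_ex[/= u uP] := box_sum_cvg Re_d dM.
have /cvg_ex[/= v vP] := box_sum_cvg Im_d dM.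
pose A N : C := ((\sum_(k : box N) complex.Re (c (box_val k)))%:C)%C.
pose B N : C := ((\sum_(k : box N) complex.Im (c (box_val k)))%:C)%C.
have Au : A N @[N --> \oo] --> ((u%:C)%C : C) by exact: cvg_real_complex uP.
have Bv : B N @[N --> \oo] --> ((v%:C)%C : C) by exact: cvg_real_complex vP.
exists (((u%:C)%C : C) + ('i%C : C) * ((v%:C)%C : C)).
have -> : psum a h = fun N => A N + ('i%C : C) * B N.
  apply/funext => N; rewrite /A /B !rmorph_sum mulr_sumr -big_split.
  by apply: eq_bigr => k _; rewrite /= -complex.complexE.
have iB : (('i%C : C) * B N) @[N --> \oo] --> ('i%C : C) * ((v%:C)%C : C).
  exact: cvgMl_tmp.
exact: (cvgD Au iB).
Qed.

Definition expands x a (f : 'rV[C]_n -> C) : Prop :=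
  exists (r M : C), [/\ 0 < r,
    forall N, psum (fun m => `|a m|) (const_mx r) N <= M
    & \forall z \near x, psum a (z - x) N @[N --> \oo] --> f z].

Lemma near_polydisc x (r : C) : 0 < r ->
  \forall z \near x, forall i, `|(z - x) 0 i| <= r.
Proof.
move=> r0; apply: filterS (nbhsx_ballx x _ r0) => z [_ xz] i.
by rewrite !mxE distrC ltW //; have := xz 0 i.
Qed.

Lemma expandsZ x a f (c : C) : expands x a f ->
  expands x (fun m => c * a m) (fun z => c * f z).
Proof.
move=> [r [M [r0 aM af]]]; exists r, (`|c| * M); split=> [//|N|].
  rewrite (_ : psum _ _ _ = `|c| * psum (fun m => `|a m|) (const_mx r) N).
    by rewrite ler_wpM2l.
  by rewrite /psum mulr_sumr; apply: eq_bigr => k _; rewrite normrM mulrA.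
apply: filterS af => z afz.
rewrite (_ : psum _ _ = fun N => c * psum a (z - x) N); first exact: cvgMl_tmp.
by apply/funext => N; rewrite /psum mulr_sumr; apply: eq_bigr => k _; rewrite mulrA.
Qed.

Lemma expandsD x a b f g : expands x a f -> expands x b g ->
  expands x (fun m => a m + b m) (fun z => f z + g z).
Proof.
move=> [r [M [r0 aM af]]] [s [L [s0 bL bg]]].
have [t [t0 tr ts]] := min_radius r0 s0.
exists t, (M + L); split=> [//|N|].
  apply: (@le_trans _ _ (psum (fun m => `|a m|) (const_mx t) N +
                         psum (fun m => `|b m|) (const_mx t) N)).
    rewrite /psum -big_split /=; apply: ler_sum => k _.
    rewrite -mulrDl ler_wpM2r ?mon_const ?exprn_ge0 ?(ltW t0) //.
    exact: ler_normD.
  apply: lerD.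
    by apply: le_trans (aM N); rewrite ler_psum // ltW.
  by apply: le_trans (bL N); rewrite ler_psum // ltW.
apply: filterS2 af bg => z afz bgz.
have -> : psum (fun m => a m + b m) (z - x) =
    fun N => psum a (z - x) N + psum b (z - x) N.
  apply/funext => N /=; rewrite /psum -big_split /=.
  by apply: eq_bigr => k _; rewrite mulrDl.
exact: (cvgD afz bgz).
Qed.

Lemma expands_conv x a b f g : expands x a f -> expands x b g ->
  expands x (conv a b) (fun z => f z * g z).
Proof.
move=> [r [M [r0 aM af]]] [s [L [s0 bL bg]]].
have [t [t0 tr ts]] := min_radius r0 s0.
have aMt N : psum (fun m => `|a m|) (const_mx t) N <= M.
  by apply: le_trans (aM N); rewrite ler_psum // ltW.
have bLt N : psum (fun m => `|b m|) (const_mx t) N <= L.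
  by apply: le_trans (bL N); rewrite ler_psum // ltW.
have M0 : 0 <= M by apply: le_trans (aMt 0%N); rewrite psum_ge0 // ltW.
have L0 : 0 <= L by apply: le_trans (bLt 0%N); rewrite psum_ge0 // ltW.
exists t, (M * L); split=> [//|N|].
  apply: le_trans (psum_conv_le _ _ _ (ltW t0)) _.
  by rewrite ler_pM ?psum_ge0 // ltW.
(* Half the radius provides the factor [2^-N] in [psum_conv_diff]. *)
have t2 : 0 < t / 2 by rewrite divr_gt0.
apply: filterS3 af bg (near_polydisc x t2) => z afz bgz xz.
pose D N := psum a (z - x) N * psum b (z - x) N - psum (conv a b) (z - x) N.
have -> : psum (conv a b) (z - x) =
    fun N => psum a (z - x) N * psum b (z - x) N - D N.
  by apply/funext => N; rewrite subKr.
have D0 : D N @[N --> \oo] --> (0 : C).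
  apply/cvgr0Pnorm_lt => eps eps0.
  have ML1 : 0 < M * L + 1 by rewrite ltr_wpDl // mulr_ge0.
  have [N0 N0P] := half_expn_small (divr_gt0 eps0 ML1).
  exists N0 => // N /= /N0P Neps.
  apply: le_lt_trans (psum_conv_diff t0 xz aMt bLt N) _.
  apply: (@le_lt_trans _ _ ((M * L + 1) * 2^-1 ^+ N)).
    by rewrite ler_wpM2r ?exprn_ge0 ?invr_ge0 // lerDl.
  by rewrite mulrC -ltr_pdivlMr.
rewrite -[f z * g z]subr0.
exact: (cvgB (cvgM afz bgz) D0).
Qed.

Lemma expands_unique x a f g :
  expands x a f -> expands x a g -> \forall z \near x, f z = g z.
Proof.
move=> [_ [_ [_ _ af]]] [_ [_ [_ _ ag]]]; apply: filterS2 af ag => z.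
exact: (cvg_unique (@norm_hausdorff _ C)).
Qed.

Lemma expands_center x a f : expands x a f -> f x = a 0.
Proof.
move=> [r [M [_ _ /nbhs_singleton]]]; rewrite subrr => af.
apply: (cvg_unique (@norm_hausdorff _ C) af).
have -> : psum a 0 = fun=> a 0; last exact: cvg_cst.
apply/funext => N; rewrite /psum (bigD1 [ffun=> ord0]) //= big1 => [|k k0].
  have -> : box_val [ffun=> ord0 : 'I_N.+1] = 0 :> mindex.
    by apply/ffunP => i; rewrite !ffunE.
  by rewrite addr0 /mon big1 ?mulr1 // => i _; rewrite ffunE expr0.
have [i ki] : exists i, k i != 0%N :> nat.
  apply/existsP; apply: contraNT k0 => /existsPn k0; apply/eqP/ffunP => i.
  by apply: val_inj; rewrite ffunE /=; apply/eqP/negbNE/k0.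
rewrite /mon (bigD1 i) //= !ffunE mxE expr0n.
by rewrite (negPf ki) mul0r mulr0.
Qed.

(** All primes are at least 2, so [2^-t < r] places the polydisc [radii t] inside the one of radius
    [r]. *)
Lemma expands_convergent x a f : expands x a f -> convergent a.
Proof.
move=> [r [M [r0 aM _]]]; have [t tr] := half_expn_small r0.
exists t, M => N; apply: le_trans (aM N); apply: ler_sum => k _.
rewrite ler_wpM2l // /mon; apply: ler_prod => i _.
rewrite !mxE exprn_ge0 ?invr_ge0 ?exprn_ge0 //=.
rewrite lerXn2r ?nnegrE ?invr_ge0 ?exprn_ge0 ?(ltW r0) //.
apply/ltW/(le_lt_trans _ (tr t (leqnn t))).
rewrite exprVn lef_pV2 ?posrE ?exprn_gt0 ?ltr0n ?prime_gt0 ?prime_seq_prime //.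
by rewrite lerXn2r ?nnegrE // ler_nat prime_gt1 // prime_seq_prime.
Qed.

Lemma convergent_expands x a : convergent a -> exists f, expands x a f.
Proof.
(* The product [p] bounds every prime involved, so the polydisc of constant radius [p^-t] lies
   inside [radii t]. *)
move=> [t [M aM]]; pose p := (\prod_(i < n) prime_seq i)%N.
have p0 : (0 < p)%N by apply: prodn_gt0 => i; rewrite prime_gt0 ?prime_seq_prime.
pose r : C := p%:R ^- t; have r0 : 0 < r by rewrite invr_gt0 exprn_gt0 ?ltr0n.
have arM N : psum (fun m => `|a m|) (const_mx r) N <= M.
  apply: le_trans (aM N); apply: ler_sum => k _.
  rewrite ler_wpM2l // /mon; apply: ler_prod => i _.
  rewrite !mxE exprn_ge0 ?(ltW r0) //= lerXn2r ?nnegrE ?invr_ge0 ?exprn_ge0 ?(ltW r0) //.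
  have i0 : (0 < prime_seq i)%N by rewrite prime_gt0 ?prime_seq_prime.
  rewrite lef_pV2 ?posrE ?exprn_gt0 ?ltr0n //.
  rewrite lerXn2r ?nnegrE // ler_nat dvdn_leq //.
  by rewrite /p (bigD1 i) //= dvdn_mulr.
have /choice[f fP] z : exists l : C, (forall i, `|(z - x) 0 i| <= r) ->
    psum a (z - x) N @[N --> \oo] --> l.
  have [zr|zr] := pselect (forall i, `|(z - x) 0 i| <= r); last by exists 0.
  by have [l lP] := psum_cvg arM zr; exists l.
exists f, r, M; split=> [//|//|].
by apply: filterS (near_polydisc x r0) => z /fP.
Qed.

End Expansions.

(** * Expansions of germs and the Noetherian property *)

Section GermExpansions.
Local Open Scope classical_set_scope.
Variables (R : realType) (n : nat) (X : germ R n).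
Local Notation C := (Cx R).
Local Notation mindex := {ffun 'I_n -> nat}.
Local Notation x := (gpt X).
Implicit Types (a b : mindex -> C) (m : mindex) (s u : local_ring X).

(** A relation and not a function: a series determines its class on [X], but a class has many
    expansions, differing by functions that vanish on [X]. *)
Definition germ_expands a s : Prop :=
  exists f : holo x, to_local X f = s /\ expands x a (val f).

Lemma holo_mem f : holomorphic_at x f -> f \in @holo_pred R n x.
Proof. by move=> fP; apply/asboolP. Qed.

Lemma to_local_eq (f g : holo x) :
  (\forall z \near x, val f z = val g z) -> to_local X f = to_local X g.
Proof.
move=> fg; apply/eqP; rewrite -subr_eq0 -rmorphB; apply/eqP/quot_map_eq0/asboolP.
apply: filterS fg => z fgz _.
by rewrite -[LHS]/(val f z - val g z) fgz subrr.
Qed.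

Lemma germ_expands_exists s : exists a, germ_expands a s.
Proof.
have [f ->] := to_local_surj s; have /asboolP[a [r [M aP]]] := valP f.
by exists a, f; split=> //; exists r, M.
Qed.

Lemma germ_expands_unique a s u : germ_expands a s -> germ_expands a u -> s = u.
Proof.
move=> [f [<- af]] [g [<- ag]]; apply: to_local_eq.
exact: expands_unique af ag.
Qed.

Lemma germ_expands_convergent a s : germ_expands a s -> convergent a.
Proof. by case=> f [_ /expands_convergent]. Qed.

Lemma convergent_germ_expands a : convergent a -> exists s, germ_expands a s.
Proof.
move=> /(convergent_expands x)[f af].
have fP : f \in @holo_pred R n x by apply: holo_mem; exists a.
by exists (to_local X (exist _ f fP)), (exist _ f fP).
Qed.

Lemma germ_expandsD a b s u : germ_expands a s -> germ_expands b u ->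
  germ_expands (fun m => a m + b m) (s + u).
Proof.
move=> [f [<- af]] [g [<- bg]]; exists (f + g); split; first exact: rmorphD.
exact: expandsD af bg.
Qed.

Lemma germ_expands_conv a b s u : germ_expands a s -> germ_expands b u ->
  germ_expands (conv a b) (s * u).
Proof.
move=> [f [<- af]] [g [<- bg]]; exists (f * g); split; first exact: rmorphM.
exact: expands_conv af bg.
Qed.

Definition cst_holo (c : C) : holo x :=
  exist _ (fun=> c) (holo_mem (holomorphic_cst x c)).

Definition cst_germ (c : C) : local_ring X := to_local X (cst_holo c).

Lemma cst_germ0 : cst_germ 0 = 0.
Proof.
rewrite -(rmorph0 (to_local X)); apply: to_local_eq.
by near=> z.
Unshelve. all: by end_near. Qed.

Lemma eval_cst_germ c : eval_pt (cst_germ c) = c.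
Proof. exact: eval_ptE. Qed.

Lemma germ_expandsZ (c : C) a s : germ_expands a s ->
  germ_expands (fun m => c * a m) (cst_germ c * s).
Proof.
move=> [f [<- af]].
exists (cst_holo c * f).
by split; [exact: rmorphM|exact: expandsZ].
Qed.

Lemma germ_expands0 : germ_expands (fun=> 0) 0.
Proof.
have [a a1] := germ_expands_exists 1; have := germ_expandsZ 0 a1.
rewrite cst_germ0 mul0r; congr germ_expands.
by apply/funext => m; rewrite mul0r.
Qed.

Lemma germ_expands_sum r (a : 'I_r -> mindex -> C) (s : 'I_r -> local_ring X) :
  (forall j, germ_expands (a j) (s j)) ->
  germ_expands (fun m => \sum_j a j m) (\sum_j s j).
Proof.
elim: r a s => [|r IHr] a s as_.
  rewrite big_ord0 (_ : (fun m => _) = fun=> 0); first exact: germ_expands0.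
  by apply/funext => m; rewrite big_ord0.
rewrite big_ord_recl (_ : (fun m => _) =
    fun m => a ord0 m + \sum_j a (lift ord0 j) m).
  by apply: germ_expandsD => //; apply: IHr.
by apply/funext => m; rewrite big_ord_recl.
Qed.

Lemma germ_expands_eval a s : germ_expands a s -> eval_pt s = a 0.
Proof. by move=> [f [<- /expands_center <-]]; exact: eval_ptE. Qed.

Lemma germ_division r (f : 'I_r -> mindex -> C) (e : 'I_r -> mindex)
    (s : 'I_r -> local_ring X) u :
  (forall j, leading (f j) (e j)) -> (forall j, germ_expands (f j) (s j)) ->
  exists (q : 'I_r -> local_ring X) (h : mindex -> C) (v : local_ring X),
    [/\ u = \sum_j q j * s j + v, germ_expands h v
      & forall j m, mle (e j) m -> h m = 0].
Proof.
move=> f_lead fs; have [g gu] := germ_expands_exists u.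
have [|q [h [qc hc gE h0]]] := weierstrass_division f_lead _ (germ_expands_convergent gu).
  by move=> j; apply: germ_expands_convergent (fs j).
have /choice[w wP] j := convergent_germ_expands (qc j).
have [v vP] := convergent_germ_expands hc.
exists w, h, v; split=> //; apply: (germ_expands_unique gu).
rewrite (_ : g = fun m => \sum_j conv (q j) (f j) m + h m).
  apply: germ_expandsD => //; apply: germ_expands_sum => j.
  exact: germ_expands_conv.
exact/funext.
Qed.

(** Standard basis argument: [E] collects the leading exponents of expansions of members of [Q], and
    Dickson's lemma selects finitely many. Division by the corresponding members leaves a remainder
    in [Q] with no exponent above a selected one. *)
Lemma local_ring_noetherian : noetherian (local_ring X).
Proof.
move=> Q [Q0 QD].
pose E e := exists a s, [/\ germ_expands a s, Q s%:M & leading a e].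
have [es [esE esP]] := dickson E.
have /choice[f /choice[s fsP]] (j : 'I_(size es)) : exists a s,
    [/\ germ_expands a s, Q s%:M & leading a (nth 0 es j)].
  by apply: esE; rewrite mem_nth.
have fE j : germ_expands (f j) (s j) by case: (fsP j).
have f_lead j : leading (f j) (nth 0 es j) by case: (fsP j).
have Qs q : Q (\sum_j q j * s j)%:M.
  rewrite (_ : _%:M = \sum_j (q j) *: (s j)%:M).
    elim/big_ind: _ => // [v w Qv Qw|j _]; first by rewrite -[v]scale1r; apply: QD.
    by rewrite -[_ *: _]addr0; apply: QD => //; case: (fsP j).
  apply/rowP => i; rewrite ord1 mxE mulr1n summxE.
  by apply: eq_bigr => j _; rewrite !mxE mulr1n.
exists (size es), (\matrix_(j, _) s j) => v.
have spanE (w : 'rV_(size es)) :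
    w *m (\matrix_(j, _) s j) = (\sum_j w 0 j * s j)%:M.
  apply/rowP => i; rewrite ord1 !mxE mulr1n.
  by apply: eq_bigr => j _; rewrite mxE.
split=> [Qv|[w ->]]; last by rewrite spanE.
have vE : v = (v 0 0)%:M by apply/rowP => i; rewrite ord1 mxE mulr1n.
have [q [h [w [uE hw h0]]]] := germ_division (v 0 0) f_lead fE.
exists (\row_j q j); rewrite spanE vE uE.
rewrite [in RHS](eq_bigr (fun j => q j * s j)) => [|j _]; last by rewrite mxE.
suff -> : w = 0 by rewrite addr0.
(* The dichotomy concerns the series [h], not its class [w]: a nonzero [h] would have its leading
   exponent in [E], even if [w] were 0. *)
have [h00|/existsNP[m hm]] := pselect (forall m, h m = 0).
  apply: germ_expands_unique germ_expands0.
  by rewrite (_ : (fun=> 0) = h) //; apply/esym/funext.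
have [|e he hlead] := @exists_leading R n h; first by exists m; apply/eqP.
have [|e' e's e'e] := esP e.
  exists (fun m => (h e)^-1 * h m), (cst_germ (h e)^-1 * w).
  split=> //; first exact: germ_expandsZ.
  have Qw : Q w%:M.
    have -> : w%:M = - 1 *: (\sum_j q j * s j)%:M + v :> 'rV_1.
      by rewrite vE uE; apply/rowP => i; rewrite ord1 !mxE !mulr1n mulN1r addKr.
    exact: QD.
  have -> : (cst_germ (h e)^-1 * w)%:M = cst_germ (h e)^-1 *: w%:M + 0 :> 'rV_1.
    by rewrite addr0; apply/rowP => i; rewrite ord1 !mxE !mulr1n.
  exact: QD.
have [j jE] : exists j : 'I_(size es), nth 0 es j = e'.
  have lt : (index e' es < size es)%N by rewrite index_mem.
  by exists (Ordinal lt); rewrite /= nth_index.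
by rewrite (h0 j e) ?eqxx ?jE // in he.
Qed.

(** The series of [s], once normalized, has leading exponent 0. Every exponent lies above 0, so
    dividing 1 by it leaves no remainder. *)
Lemma local_ring_unit s : eval_pt s != 0 -> exists u, u * s = 1.
Proof.
have [a aS] := germ_expands_exists s; rewrite (germ_expands_eval aS) => a0.
pose c := (a 0)^-1; pose f (_ : 'I_1) m := c * a m.
have [||q [h [w [E hw h0]]]] := @germ_division 1 f (fun=> 0)
    (fun=> cst_germ c * s) 1.
- move=> j; rewrite /f; split=> [|m m0 _]; first by rewrite mulVf.
  by rewrite code0 code_gt1.
- by move=> j; apply: germ_expandsZ.
exists (q ord0 * cst_germ c); rewrite -mulrA E big_ord1.
suff -> : w = 0 by rewrite addr0.
apply: germ_expands_unique germ_expands0.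
rewrite (_ : (fun=> 0) = h) //; apply/esym/funext => m; apply: (h0 ord0).
by apply/forallP => i; rewrite ffunE.
Qed.

Lemma local_alg_noetherian : local_noetherian (local_alg X).
Proof.
split; first exact: local_ring_noetherian.
  by move=> c; exists (cst_germ c); exact: eval_cst_germ.
exact: local_ring_unit.
Qed.

End GermExpansions.

(** * Gluings *)

Section Germs.
Variable R : realType.

(** Values lie in a field, so a function vanishes wherever a power of it does. Hence the comorphism
    of [alpha] has a radical kernel, as largeness requires. *)
Lemma local_ring_reduced n (X : germ R n) (s : local_ring X) r : s ^+ r = 0 -> s = 0.
Proof.
have [f ->] := to_local_surj s; rewrite -rmorphXn => /quot_map_eq0/asboolP fr0.
apply/quot_map_eq0/asboolP; apply: filterS fr0 => z fz Xz.
have /eqP := fz Xz; have -> : val (f ^+ r) z = val f z ^+ r.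
  elim: r {fz} => [|r IHr]; first by rewrite !expr0.
  by rewrite !exprS -IHr.
by rewrite expf_eq0 => /andP[_ /eqP].
Qed.

(** Comorphisms are local: [gm_pullE] is evaluated at the base point, which [alpha] preserves. *)
Lemma residue_pull l n (Z : germ R l) (X : germ R n) (alpha : germ_morphism Z X)
  (s : local_alg X) : residue (local_alg Z) (gm_pull alpha s) = residue (local_alg X) s.
Proof.
have [f ->] := to_local_surj s.
have [g gE] := to_local_surj (gm_pull alpha (to_local X f)).
have /nbhs_singleton/(_ (gpt_in Z)) := gm_pullE gE; rewrite gm_pt.
by move=> gf; rewrite gE -[LHS]/(eval_pt _) -[RHS]/(eval_pt _) !eval_ptE.
Qed.

End Germs.

Section Gluing.
Variables (R : realType) (n m l : nat).
Variables (X : germ R n) (Y : germ R m) (Z : germ R l).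
Variables (alpha : germ_morphism Z X) (beta : germ_morphism Z Y).
Hypothesis alpha_surj : forall t, exists s, gm_pull alpha s = t.
Hypothesis beta_surj : forall t, exists s, gm_pull beta s = t.
Local Notation V := (glue alpha beta).
Local Notation p1 := (glue_pr1 alpha beta).
Local Notation p2 := (glue_pr2 alpha beta).

Lemma glue_fiber s t : gm_pull alpha s = gm_pull beta t ->
  exists w : V, p1 w = s /\ p2 w = t.
Proof.
move=> st; have stP : (s, t) \in fiber_pred (gm_pull alpha) (gm_pull beta).
  by rewrite unfold_in /= st.
by exists (exist _ (s, t) stP).
Qed.

Lemma glue_pullE (w : V) : gm_pull alpha (p1 w) = gm_pull beta (p2 w).
Proof. exact/eqP/(valP w). Qed.

Lemma glue_inj (w w' : V) : p1 w = p1 w' -> p2 w = p2 w' -> w = w'.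
Proof.
exact: fiber_inj.
Qed.

Lemma glue_pr1_surj s : exists w : V, p1 w = s.
Proof.
have [t /esym/glue_fiber[w [<- _]]] := beta_surj (gm_pull alpha s).
by exists w.
Qed.

Lemma glue_pr2_surj t : exists w : V, p2 w = t.
Proof.
have [s /glue_fiber[w [_ <-]]] := alpha_surj (gm_pull beta t).
by exists w.
Qed.

Lemma residue_glue2 (w : V) : residue V w = residue (local_alg Y) (p2 w).
Proof. by rewrite -(residue_pull beta) -glue_pullE residue_pull. Qed.

Lemma glue_local_noetherian : local_noetherian V.
Proof.
apply: (local_noetherian_fiber (a := gm_pull alpha) (b := gm_pull beta)
  (local_alg_noetherian X) (local_alg_noetherian Y) glue_pr1_surj glue_pr2_surj
  glue_pullE glue_inj glue_fiber (fun=> erefl) residue_glue2).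
Qed.

Hypothesis glue_large : large_gluing alpha beta.

(** Largeness is applied to the subspace [Z] of [X], whose ideal is the kernel of the comorphism of
    [alpha]. *)
Lemma betti_glue : let b i := betti (local_alg X) (pull_module (gm_pull alpha)) i in
  betti V (pull_module p2) 1 = b 1%N /\
  betti V (pull_module p2) 2 = (b 2%N + b 1%N * betti V (pull_module p1) 1)%N.
Proof.
move=> b; have lnX := local_alg_noetherian X; have lnV := glue_local_noetherian.
have qX : cyclic_quotient (kernel (gm_pull alpha)) (pull_module (gm_pull alpha)).
  exact: cyclic_quotient_pull.
have a_local s : gm_pull alpha s = 0 -> residue (local_alg X) s = 0.
  by move=> s0; rewrite -(residue_pull alpha) s0 rmorph0.
(* [large] speaks of the quotient by the kernel ideal, the conclusion of the target ring itself;
   both are cyclic quotients by the same submodule. *)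
have qX' : cyclic_quotient (kernel (gm_pull alpha))
    (quot_module (kernel_ideal (gm_pull alpha))).
  apply: cyclic_quotient_ext (cyclic_quotient_quot _) => v.
  exact: kernel_idealP.
have qV1 : cyclic_quotient (kernel p1) (pull_module p1).
  exact: cyclic_quotient_pull glue_pr1_surj.
have qVK : cyclic_quotient (kernel (gm_pull alpha \o p1 : {rmorphism V -> _}))
    (restr p1 (quot_module (kernel_ideal (gm_pull alpha)))).
  apply: cyclic_quotient_ext (cyclic_quotient_restr glue_pr1_surj qX') => v.
  by rewrite /kernel mxE.
have [r1 [r2 [D0 [D1 [_ _ _ D1b]]]]] := minimal_presentation lnX
  (kernel_submodule (gm_pull alpha)) (fun v => @a_local (v 0 0)).
have [bX0 bX1 bX2] := D1b _ qX; have [bX0' bX1' bX2'] := D1b _ qX'.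
apply: (betti_fiber lnX lnV glue_pr1_surj glue_pullE glue_inj glue_fiber a_local
  (fun=> erefl) qV1 (cyclic_quotient_pull glue_pr2_surj) qVK qX).
(* The coefficient of degree 2 has three terms; the zeroth Betti numbers occurring in them are 1. *)
have := congr1 (fun p => p 2%N) (glue_large
  (radical_kernel_ideal (h := gm_pull alpha) (@local_ring_reduced _ _ Z))).
rewrite /series_mul /poincare 3!big_ord_recl big_ord0 /= addn0 => ->.
have ker1 v : kernel p1 v -> residue V (v 0 0) = 0.
  by rewrite /kernel /= => ->; rewrite rmorph0.
have [g1 [g2 [C0 [C1 [_ _ _ /(_ _ qV1)[gV0 _ _]]]]]] :=
  minimal_presentation lnV (kernel_submodule p1) ker1.
rewrite bX0' bX1' bX2' bX1 bX2 subn0 subnn gV0 mul1n muln1.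
rewrite (_ : 2 - bump 0 0 = 1)%N // addnC; congr (_ + _)%N.
by rewrite addnC.
Qed.

(** Largeness is applied to the reduced point, and the coefficients of degree 1 are compared. *)
Lemma edim_glue : edim V = (edim (local_alg X) + betti V (pull_module p1) 1)%N.
Proof.
have lnX := local_alg_noetherian X; have lnV := glue_local_noetherian.
pose res := residue (local_alg X).
have qX : cyclic_quotient (@max_ideal _ (local_alg X)) (quot_module (kernel_ideal res)).
  apply: cyclic_quotient_ext (cyclic_quotient_quot _) => v.
  exact: kernel_idealP.
have qV : cyclic_quotient (@max_ideal _ V) (restr p1 (quot_module (kernel_ideal res))).
  apply: cyclic_quotient_ext (cyclic_quotient_restr glue_pr1_surj qX) => v.
  by rewrite /max_ideal mxE.
rewrite (edim_betti lnX qX) (edim_betti lnV qV).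
have Cred (t : Cx R) r : t ^+ r = 0 -> t = 0.
  by move/eqP; rewrite expf_eq0 => /andP[_ /eqP].
have := congr1 (fun p => p 1%N) (glue_large (radical_kernel_ideal (h := res) Cred)).
rewrite /series_mul /poincare 2!big_ord_recl big_ord0 /= addn0 => ->.
have [r1 [r2 [D0 [D1 [_ _ _ /(_ _ qX)[-> _ _]]]]]] :=
  minimal_presentation lnX (max_ideal_submodule _) (fun v vm => vm).
have ker1 v : kernel p1 v -> residue V (v 0 0) = 0.
  by rewrite /kernel /= => ->; rewrite rmorph0.
have [g1 [g2 [C0 [C1 [_ _ _ /(_ _ (cyclic_quotient_pull glue_pr1_surj))[gV0 _ _]]]]]] :=
  minimal_presentation lnV (kernel_submodule p1) ker1.
by rewrite gV0 muln1 mul1n addnC.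
Qed.

End Gluing.

Theorem proposition4p2 (R : realType) (n m l : nat)
    (X : germ R n) (Y : germ R m) (Z : germ R l)
    (alpha : germ_morphism Z X) (beta : germ_morphism Z Y)
    (alpha_surj : forall t, exists s, gm_pull alpha s = t)
    (alpha_not_iso : ~ bijective (gm_pull alpha))
    (beta_surj : forall t, exists s, gm_pull beta s = t)
    (beta_not_iso : ~ bijective (gm_pull beta))
    (dim_glue : krull_dim (glue alpha beta) = krull_dim (local_alg X))
    (glue_large : large_gluing alpha beta) :
  let V := glue alpha beta in
  let b_XZ i := Posz (betti (local_alg X) (pull_module (gm_pull alpha)) i) in
  let b_VY i := Posz (betti V (pull_module (glue_pr2 alpha beta)) i) in
  let edimX := Posz (edim (local_alg X)) in
  let dimX := Posz (krull_dim (local_alg X)) in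
  smooth V <->
  (b_XZ 1%N * (b_VY 1%N * edimX - dimX * b_XZ 1%N + b_VY 2%N) =
   b_VY 1%N * b_XZ 2%N)%R.
Proof.
move=> V b_XZ b_VY edimX dimX; rewrite /b_VY.
have [-> ->] := betti_glue alpha_surj beta_surj glue_large.
rewrite /smooth dim_glue (edim_glue alpha_surj beta_surj glue_large).
rewrite -/V /dimX /edimX /b_XZ {b_XZ b_VY edimX dimX}.
have : (0 < betti (local_alg X) (pull_module (gm_pull alpha)) 1)%N.
  apply: (betti1_kernel_gt0 (local_alg_noetherian X) _ (cyclic_quotient_pull alpha_surj)).
    by move=> s s0; rewrite -(residue_pull alpha) s0 rmorph0.
  (* With a zero kernel the surjective comorphism would be bijective. *)
  apply: contrapT => ker0; apply: alpha_not_iso.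
  have inj : injective (gm_pull alpha).
    move=> s t st; apply/eqP; rewrite -subr_eq0; apply: contrapT => /negP d0.
    by apply: ker0; exists (s - t); rewrite // rmorphB st subrr.
  have [g gK] := choice alpha_surj.
  by exists g => // s; apply: inj; rewrite gK.
move: (betti _ _ 1) (betti _ _ 2) (betti _ _ 1) (edim _) (krull_dim _).
move=> c b2 b1 e d b1_gt0.
rewrite PoszD PoszM; split=> [<-|/eqP].
  by rewrite PoszD; ring.
rewrite -subr_eq0.
(* The two sides differ by [b1^2] times the difference of [e + c], the embedding dimension of the
   gluing, and the dimension [d]. *)
have -> : Posz b1 * (Posz b1 * Posz e - Posz d * Posz b1 + (Posz b2 + Posz b1 * Posz c))
  - Posz b1 * Posz b2 = Posz b1 * Posz b1 * (Posz (e + c) - Posz d).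
  by rewrite PoszD; ring.
by rewrite !mulf_eq0 subr_eq0 orbb => /orP[/eqP[b10]|/eqP[]//]; rewrite b10 in b1_gt0.
Qed.
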